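(* For any $f\in\mathcal{MG}(A_{p,q})$ and any triangulation $\Gamma$ of $A_{p,q}$, one has $$\phi(f(\Gamma))=\psi(f)(\phi(\Gamma))$$ (equality of isomorphism classes of tilting sheaves in $\mathrm{coh}\text{-}\mathbb{X}(p,q)$).
   Context: Sheaves. Let $\mathbf{k}$ be an algebraically closed field and $1\le p\le q$ integers. $\mathbb{L}(p,q)$ is the abelian group on generators $\vec{x}_1,\vec{x}_2$ with relation $p\vec{x}_1=q\vec{x}_2=:\vec{c}$. $S=\mathbf{k}[x_1,x_2]$ is $\mathbb{L}(p,q)$-graded with $\deg x_i=\vec{x}_i$. $\mathrm{coh}\text{-}\mathbb{X}(p,q)$ (coherent sheaves on the weighted projective line of type $(p,q)$) is the quotient of the category of finitely generated $\mathbb{L}(p,q)$-graded $S$-modules by the Serre subcategory of finite dimensional modules; $\mathcal{O}$ is the image of $S$ and $(\vec{x})$ denotes the grading shift, an auto-equivalence. Its indecomposable objects are: the line bundles $\mathcal{O}(\vec{x})$, $\vec{x}\in\mathbb{L}(p,q)$ (these are all indecomposable vector bundles), and the uniserial torsion sheaves $S_{\infty,i}^{(j)}$ ($i\in\mathbb{Z}/p$), $S_{0,i}^{(j)}$ ($i\in\mathbb{Z}/q$), $S_\lambda^{(j)}$ ($\lambda\in\mathbf{k}^*$), $j\ge1$, of length $j$ with simple top $S_{\infty,i}=\mathrm{coker}(x_1:\mathcal{O}((i-1)\vec{x}_1)\to\mathcal{O}(i\vec{x}_1))$, $S_{0,i}=\mathrm{coker}(x_2:\mathcal{O}((i-1)\vec{x}_2)\to\mathcal{O}(i\vec{x}_2))$,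 $S_\lambda=\mathrm{coker}(x_2^q-\lambda x_1^p:\mathcal{O}\to\mathcal{O}(\vec{c}))$ respectively. Tilting. A sheaf $T$ is tilting if $\mathrm{Ext}^1(T,T)=0$ and $\mathrm{Hom}(T,X)=0=\mathrm{Ext}^1(T,X)$ implies $X=0$. Tilting sheaves are taken multiplicity-free and up to isomorphism; they have exactly $p+q$ indecomposable summands. Annulus. Let $\mathbb{U}=\mathbb{R}\times[0,1]$ and $\pi:\mathbb{U}\to A_{p,q}$ the quotient by $(x,y)\sim(x+1,y)$; the line $y=1$ covers the inner boundary $\partial$, the line $y=0$ the outer boundary $\partial'$. Marked points are the images of $(\tfrac{i}{p})_\partial:=(\tfrac{i}{p},1)$ and $(\tfrac{j}{q})_{\partial'}:=(\tfrac{j}{q},0)$, $i,j\in\mathbb{Z}$. Write $[P,Q]$ for the oriented curve in $\mathbb{U}$ from $P$ to $Q$ with interior in the interior of $\mathbb{U}$ (unique up to homotopy). Put $D^{i/p}_{j/q}=[(\tfrac{j}{q})_{\partial'},(\tfrac{i}{p})_\partial]$ (positive bridging arcs) and, for $j-i\ge2$, $D^{i/p,j/p}=[(\tfrac{i}{p})_\partial,(\tfrac{j}{p})_\partial]$, $D_{i/q,j/q}=[(\tfrac{i}{q})_{\partial'},(\tfrac{j}{q})_{\partial'}]$ (peripheral arcs). Square brackets around these denote the homotopy classes of their images in $A_{p,q}$; such an image is an arc of $A_{p,q}$ if it can be represented without self-intersection in the interior. A triangulation of $A_{p,q}$ is a maximal collection of (homotopy classes of) arcs that pairwise do not intersect in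 the interior of $A_{p,q}$; its arcs are always given the orientations above (so bridging arcs go from $\partial'$ to $\partial$). The map $\phi$: $\phi([D^{i/p}_{j/q}])=\mathcal{O}(i\vec{x}_1-j\vec{x}_2)$, $\phi([D^{(i-j-1)/p,\,i/p}])=S_{\infty,i}^{(j)}$, $\phi([D_{-i/q,\,(j-i+1)/q}])=S_{0,i}^{(j)}$ ($j\geq 1$ in the last two), and for a triangulation $\phi(\Gamma)=\bigoplus_{\gamma\in\Gamma}\phi(\gamma)$, which is a tilting sheaf. Groups. $\mathcal{MG}(A_{p,q})$ is the group of orientation-preserving homeomorphisms of the annulus mapping the set $M$ of marked points to itself (boundary components may be interchanged), modulo those isotopic to the identity through homeomorphisms along an isotopy fixing $M$ pointwise. It is generated by $r_1,r_2$ and, when $p=q$, also $\sigma$; these are the classes with lifts to $\mathbb{U}$ acting on marked points by $r_1:(\tfrac{a}{p})_\partial\mapsto(\tfrac{a+1}{p})_\partial,\ (\tfrac{b}{q})_{\partial'}\mapsto(\tfrac{b}{q})_{\partial'}$; $r_2:(\tfrac{a}{p})_\partial\mapsto(\tfrac{a}{p})_\partial,\ (\tfrac{b}{q})_{\partial'}\mapsto(\tfrac{b-1}{q})_{\partial'}$; $\sigma:(\tfrac{a}{p})_\partial\mapsto(-\tfrac{a}{p})_{\partial'}$, $(\tfrac{a}{p})_{\partial'}\mapsto(-\tfrac{a}{p})_{\partial}$ (i.e. $\sigma$ is induced by $(x,y)\mapsto(-x,1-y)$). $f(\Gamma)$ is the triangulation formed by the images of the arcs of $\Gamma$, reoriented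 according to the convention above. $\mathrm{Aut}(\mathrm{coh}\text{-}\mathbb{X}(p,q))$ is the group of isomorphism classes of $\mathbf{k}$-linear self-equivalences, and $\psi:\mathcal{MG}(A_{p,q})\to\mathrm{Aut}(\mathrm{coh}\text{-}\mathbb{X}(p,q))$ is the group homomorphism with $r_1\mapsto(\vec{x}_1)$, $r_2\mapsto(\vec{x}_2)$ and, when $p=q$, $\sigma\mapsto\sigma_{1,2}$, where $\sigma_{1,2}$ is the self-equivalence exchanging the exceptional points $\infty$ and $0$ (swapping $x_1,x_2$): $\mathcal{O}(l_1\vec{x}_1+l_2\vec{x}_2+l\vec{c})\mapsto\mathcal{O}(l_1\vec{x}_2+l_2\vec{x}_1+l\vec{c})$, $S_{\infty,i}^{(j)}\leftrightarrow S_{0,i}^{(j)}$. *)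

(* Defs.v *)
From HB Require Import structures.
From mathcomp Require Import all_boot all_order all_algebra all_fingroup.
From mathcomp Require Import generic_quotient ring_quotient.
From mathcomp Require Import all_classical all_reals all_analysis.
(* The notations of mpoly clash with those of mathcomp-analysis. *)
From mathcomp Require Import -(notations) mpoly.

Set Implicit Arguments.
Unset Strict Implicit.
Unset Printing Implicit Defensive.

Import Order.TTheory GRing.Theory Num.Theory.
Import numFieldNormedType.Exports.

Local Open Scope classical_set_scope.
Local Open Scope ring_scope.
Local Open Scope quotient_scope.

Definition Lrel (p q : nat) : {pred int * int} :=
  fun u => `[< exists n : int, u = (n * p%:Z, - (n * q%:Z)) >].

Lemma Lrel_zmod_closed p q : zmod_closed (Lrel p q).
Proof.
split; first by apply/asboolP; exists 0; rewrite !mul0r oppr0.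
move=> u v /asboolP[m ->] /asboolP[n ->]; apply/asboolP; exists (m - n).
by rewrite !mulrBl !opprB /=; congr pair; rewrite /= opprK addrC.
Qed.

HB.instance Definition _ p q :=
  GRing.isZmodClosed.Build (int * int)%type (Lrel p q) (Lrel_zmod_closed p q).

Definition L (p q : nat) : zmodType := Quotient.quot (Lrel p q).

Definition Lmk p q (a b : int) : L p q := \pi_(Quotient.quot (Lrel p q)) (a, b).

Definition x1 p q : L p q := Lmk p q 1 0.
Definition x2 p q : L p q := Lmk p q 0 1.

Lemma LmkP p q (a b a' b' : int) :
  Lmk p q a b = Lmk p q a' b' <->
  exists n : int, a - a' = n * p%:Z /\ b - b' = - (n * q%:Z).
Proof.
rewrite /Lmk; split.
  move/eqP; rewrite -Quotient.idealrBE => /asboolP[n e]; exists n.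
  by case: e.
move=> [n [ea eb]]; apply/eqP; rewrite -Quotient.idealrBE; apply/asboolP.
by exists n; rewrite -ea -eb.
Qed.

Lemma LmkD p q (a b a' b' : int) :
  Lmk p q (a + a') (b + b') = Lmk p q a b + Lmk p q a' b'.
Proof. exact: (Quotient.pi_add (Lrel p q) (a, b) (a', b')). Qed.

Lemma Lmk_surj p q (x : L p q) : exists a b, x = Lmk p q a b.
Proof. by exists (repr x).1, (repr x).2; rewrite /Lmk -surjective_pairing reprK. Qed.

Notation polS k := (mpoly 2 k).

Section Span.
Variables (k : closedFieldType) (M : lmodType (polS k)).

Definition spanned (s : seq M) : set M :=
  [set u | exists c : nat -> k,
    u = \sum_(i < size s) mpolyC 2 (c i) *: s`_i].

Definition findim (W : set M) : Prop := exists s, W `<=` spanned s.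

Definition fincodim (W : set M) : Prop :=
  exists s, forall u, exists2 w, W w & spanned s (u - w).

Lemma spanned_nil u : spanned [::] u <-> u = 0.
Proof.
by split=> [[c ->]|->]; [|exists (fun=> 0)]; rewrite big_ord0.
Qed.

Lemma spanned_cons a s u :
  spanned (a :: s) u <-> exists c v, spanned s v /\ u = mpolyC 2 c *: a + v.
Proof.
split=> [[c ->]|[c [v [[d ->] ->]]]].
  by rewrite big_ord_recl; do 2!eexists; split; [exists (fun i => c i.+1)|].
by exists (fun i => if i is j.+1 then d j else c); rewrite big_ord_recl.
Qed.

Lemma spanned0 s : spanned s 0.
Proof.
exists (fun=> 0); rewrite big1 // => i _.
by rewrite mpolyC0 scale0r.
Qed.

Lemma spanned_lin s c u v :
  spanned s u -> spanned s v -> spanned s (mpolyC 2 c *: u + v).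
Proof.
move=> [a ->] [b ->]; exists (fun i => c * a i + b i).
rewrite scaler_sumr -big_split; apply: eq_bigr => i _ /=.
by rewrite mpolyCD mpolyCM scalerDl scalerA.
Qed.

Lemma spannedD s u v : spanned s u -> spanned s v -> spanned s (u + v).
Proof. by move=> su sv; rewrite -[u]scale1r -mpolyC1; apply: spanned_lin. Qed.

Lemma spannedZ s c u : spanned s u -> spanned s (mpolyC 2 c *: u).
Proof. by move=> su; rewrite -[_ *: _]addr0; apply/spanned_lin/spanned0. Qed.

Lemma spanned_cat s t u v :
  spanned s u -> spanned t v -> spanned (s ++ t) (u + v).
Proof.
elim: s u => [|a s IHs] u /=; first by move=> /spanned_nil ->; rewrite add0r.
move=> /spanned_cons[c [w [sw ->]]] tv; apply/spanned_cons.
by exists c, (w + v); split; [apply: IHs | rewrite addrA].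
Qed.

Definition ksubspace (W : set M) :=
  W 0 /\ forall c u v, W u -> W v -> W (mpolyC 2 c *: u + v).

End Span.

Section LinRel.
Variables (k : closedFieldType) (M N : lmodType (polS k)).
Variable G : M -> N -> Prop.
Hypothesis Glin : forall c m n m' n', G m n -> G m' n' ->
  G (mpolyC 2 c *: m + m') (mpolyC 2 c *: n + n').

Let Gsub c m n m' n' : G m n -> G m' n' ->
  G (m - mpolyC 2 c *: m') (n - mpolyC 2 c *: n').
Proof.
move=> h h'; rewrite -!scaleNr -mpolyCN [m + _]addrC [n + _]addrC.
exact: Glin.
Qed.

Lemma linrel_preim t (W : set N) : ksubspace W ->
  (forall m n, G m n -> exists2 w, W w & spanned t (n - w)) ->
  exists s : seq M, forall m n, G m n ->
    exists m' n', [/\ G m' n', W n' & spanned s (m - m')].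
Proof.
elim: t W => [|a t IHt] W [W0 Wlin] tW.
  exists [::] => m n Gmn; exists m, n; split=> //.
    by have [w Ww /spanned_nil/eqP] := tW _ _ Gmn; rewrite subr_eq0 => /eqP ->.
  by apply/spanned_nil; rewrite subrr.
pose W' := [set u | exists c w, W w /\ u = mpolyC 2 c *: a + w].
have [||s sP] := IHt W'.
- split=> [|c u v [d [w [Ww ->]]] [d' [w' [Ww' ->]]]].
    by exists 0, 0; rewrite mpolyC0 scale0r addr0.
  exists (c * d + d'), (mpolyC 2 c *: w + w'); split; first exact: Wlin.
  by rewrite scalerDr scalerA mpolyCD mpolyCM scalerDl addrACA.
- move=> m n /tW[w Ww /spanned_cons[c [v [tv e]]]].
  exists (mpolyC 2 c *: a + w); first by exists c, w.
  by rewrite opprD addrA addrAC e addrAC subrr add0r.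
have [[m0 [n0 [G0n [c0 [w0 [c0n0 Ww0 e0]]]]]]|no] := pselect (exists m0 n0,
  G m0 n0 /\ exists c0 w0, [/\ c0 != 0, W w0 & n0 = mpolyC 2 c0 *: a + w0]).
  exists (m0 :: s) => m n /sP[m1 [n1 [G1 [c [w [Ww e1]]] s1]]].
  exists (m1 - mpolyC 2 (c / c0) *: m0), (n1 - mpolyC 2 (c / c0) *: n0); split.
  - exact: Gsub.
  - rewrite e1 e0 scalerDr scalerA -mpolyCM divfK // opprD addrACA subrr add0r.
    by rewrite -scaleNr -mpolyCN addrC; apply: Wlin.
  - apply/spanned_cons; exists (c / c0), (m - m1); split=> //.
    by rewrite opprB addrA addrAC addrC.
exists s => m n /sP[m1 [n1 [G1 [c [w [Ww e1]]] s1]]].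
exists m1, n1; split=> //; have [c0|cn0] := eqVneq c 0.
  by rewrite e1 c0 mpolyC0 scale0r add0r.
by case: no; exists m1, n1; split=> //; exists c, w.
Qed.

Lemma linrel_image t :
  findim [set n | G 0 n] -> findim [set n | exists2 m, spanned t m & G m n].
Proof.
move=> [s0 s0P]; elim: t => [|a t [s sP]].
  by exists s0 => n [m /spanned_nil ->] /s0P.
have [[m0 [n0 [G0n [c0 [v0 [c0n0 tv0 e0]]]]]]|no] := pselect (exists m0 n0,
  G m0 n0 /\
  exists c0 v0, [/\ c0 != 0, spanned t v0 & m0 = mpolyC 2 c0 *: a + v0]).
  exists (n0 :: s) => n [m /spanned_cons[c [v [tv e]]] Gmn].
  apply/spanned_cons; exists (c / c0), (n - mpolyC 2 (c / c0) *: n0).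
  split; last by rewrite addrC subrK.
  apply: sP; exists (m - mpolyC 2 (c / c0) *: m0); last exact: Gsub.
  rewrite e e0 scalerDr scalerA -mpolyCM divfK // opprD addrACA subrr add0r.
  by rewrite -scaleNr -mpolyCN addrC; apply: spanned_lin.
exists s => n [m /spanned_cons[c [v [tv e]]] Gmn]; apply: sP; exists m => //.
have [c0|cn0] := eqVneq c 0; first by rewrite e c0 mpolyC0 scale0r add0r.
by case: no; exists m, n; split=> //; exists c, v.
Qed.

End LinRel.

Section GradedModules.
Variables (k : closedFieldType) (p q : nat).
Local Notation S := (polS k).
Local Notation L := (L p q).

Definition mdegL (m : multinom 2) : L := x1 p q *+ m 0 + x2 p q *+ m 1.

Definition homog (d : L) (f : S) : Prop :=
  forall m, m \in msupp f -> mdegL m = d.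

Lemma homogM d e f g : homog d f -> homog e g -> homog (d + e) (f * g).
Proof.
move=> hf hg m /msuppM_le /allpairsP[[m1 m2] /= [/hf <- /hg <- ->]].
rewrite /mdegL !mnmDE !mulrnDr.
by rewrite [RHS]addrACA.
Qed.

Lemma homogD d f g : homog d f -> homog d g -> homog d (f + g).
Proof. by move=> hf hg m /msuppD_le; rewrite mem_cat => /orP[/hf|/hg]. Qed.

Lemma homog0 d : homog d 0.
Proof. by move=> m; rewrite msupp0. Qed.

Lemma homogC c : homog 0 (mpolyC 2 c).
Proof.
move=> m; rewrite msuppC; case: ifP => // _; rewrite inE => /eqP ->.
by rewrite /mdegL !mnmE addr0.
Qed.

Lemma homogX (m : multinom 2) : homog (mdegL m) (mpolyX k m).
Proof. by move=> m'; rewrite msuppX inE => /eqP ->. Qed.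

Record grmod := GrMod {
  gr_car :> lmodType S;
  gr_comp : L -> set gr_car;
  gr_comp0 : forall d, gr_comp d 0;
  gr_compD : forall d u v, gr_comp d u -> gr_comp d v -> gr_comp d (u + v);
  gr_compZ : forall d e f u, homog e f -> gr_comp d u -> gr_comp (d + e) (f *: u);
  gr_decomp : forall u, exists (s : seq L) (h : L -> gr_car),
    [/\ uniq s, forall d, gr_comp d (h d) & u = \sum_(d <- s) h d];
  gr_direct : forall (s : seq L) (h : L -> gr_car),
    uniq s -> (forall d, gr_comp d (h d)) -> \sum_(d <- s) h d = 0 ->
    forall d, d \in s -> h d = 0;
  gr_fg : exists s : seq gr_car,
    forall u, exists c : nat -> S, u = \sum_(i < size s) c i *: s`_i
}.

(* The objects of coh-X(p,q) are those of the category of graded modules and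
   its morphisms are those of the Serre quotient: by definition, Hom(M, N) is
   the colimit of the spaces of graded homomorphisms M' -> N / N' over the
   graded submodules M' of M of finite codimension and N' of N of finite
   dimension.  Such a homomorphism is given here by its graph, the graded
   submodule of all (m, n) in M x N with m in M' and n in the image of m; then
   M' and N' are recovered as in [hom_dom], [hom_ind].  Two homomorphisms are
   identified in the colimit iff their difference, wherever both are defined,
   has a finite dimensional image. *)
Record hom (M N : grmod) := Hom {
  hrel :> M -> N -> Prop;
  hom0 : hrel 0 0;
  hom_lin : forall (f : S) m n m' n', hrel m n -> hrel m' n' ->
    hrel (f *: m + m') (f *: n + n');
  hom_graded : forall m n, hrel m n ->
    exists (s : seq L) (h : L -> M) (h' : L -> N),
    [/\ uniq s,
        forall d, [/\ gr_comp d (h d), gr_comp d (h' d) & hrel (h d) (h' d)],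
        m = \sum_(d <- s) h d & n = \sum_(d <- s) h' d];
  hom_dom : fincodim [set m | exists n, hrel m n];
  hom_ind : findim [set n | hrel 0 n]
}.

Definition homeq M N (f g : hom M N) : Prop :=
  findim [set u : N | exists m n n', [/\ f m n, g m n' & u = n - n']].

Definition homnull M N (f : hom M N) : Prop :=
  findim [set n : N | exists m, f m n].

Lemma hom_klin M N (f : hom M N) c m n m' n' : f m n -> f m' n' ->
  f (mpolyC 2 c *: m + m') (mpolyC 2 c *: n + n').
Proof. exact: hom_lin. Qed.

Lemma hom_dom_ksubspace M N (f : hom M N) : ksubspace [set m | exists n, f m n].
Proof.
split=> [|c u v [a ua] [b vb]]; first by exists 0; apply: hom0.
by exists (mpolyC 2 c *: a + b); apply: hom_lin.
Qed.

Lemma gr_extend (M : grmod) (s r : seq L) (h : L -> M) :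
  uniq s -> uniq r -> {subset s <= r} ->
  \sum_(d <- s) h d = \sum_(d <- r) (if d \in s then h d else 0).
Proof.
move=> us ur sr; rewrite -big_mkcond -big_filter; apply: perm_big.
apply: uniq_perm => //; first exact: filter_uniq.
by move=> d; rewrite mem_filter; case: (boolP (d \in s)) => // /sr ->.
Qed.

Lemma gr_unique (M : grmod) (s t : seq L) (h g : L -> M) :
  uniq s -> uniq t ->
  (forall d, gr_comp d (h d)) -> (forall d, gr_comp d (g d)) ->
  \sum_(d <- s) h d = \sum_(d <- t) g d ->
  forall d, (if d \in s then h d else 0) = (if d \in t then g d else 0).
Proof.
move=> us ut hh hg e.
pose r := undup (s ++ t); have ur : uniq r by exact: undup_uniq.
have sr : {subset s <= r} by move=> d ds; rewrite mem_undup mem_cat ds.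
have tr : {subset t <= r} by move=> d dt; rewrite mem_undup mem_cat dt orbT.
pose y d := (if d \in s then h d else 0) - (if d \in t then g d else 0).
have y0 d : d \in r -> y d = 0.
  apply: (gr_direct ur) => [{}d|]; rewrite ?/y.
    apply: gr_compD; first by case: ifP => _; [exact: hh | exact: gr_comp0].
    rewrite -scaleN1r -mpolyC1 -mpolyCN -[d in gr_comp d]addr0 addrC -[0 + d]addrC.
    apply: gr_compZ; first exact: homogC.
    by case: ifP => _; [exact: hg | exact: gr_comp0].
  by rewrite big_split sumrN /= -!gr_extend // e subrr.
move=> d; have [/y0/eqP|] := boolP (d \in r).
  by rewrite subr_eq0 => /eqP.
by rewrite mem_undup mem_cat negb_or => /andP[/negbTE -> /negbTE ->].
Qed.

Definition idhom_rel (M : grmod) (m n : M) : Prop := m = n.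

Program Definition idhom (M : grmod) : hom M M :=
  @Hom M M (@idhom_rel M) _ _ _ _ _.
Next Obligation. by []. Qed.
Next Obligation. by move=> M f m n m' n' -> ->. Qed.
Next Obligation.
move=> M m n <-; have [s [h [us hh ->]]] := gr_decomp m.
by exists s, h, h; split=> // d; split.
Qed.
Next Obligation.
move=> M; exists [::] => u; exists u; first by exists u.
by rewrite subrr; apply: spanned0.
Qed.
Next Obligation. by move=> M; exists [::] => u <-; apply: spanned0. Qed.

Definition hcomp_rel M N P (g : hom N P) (f : hom M N) (m : M) (l : P) : Prop :=
  exists2 n, f m n & g n l.

Program Definition hcomp M N P (g : hom N P) (f : hom M N) : hom M P :=
  @Hom M P (hcomp_rel g f) _ _ _ _ _.
Next Obligation. by move=> M N P g f; exists 0; apply: hom0. Qed.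
Next Obligation.
move=> M N P g f c m l m' l' [n mn nl] [n' mn' nl'].
by exists (c *: n + n'); apply: hom_lin.
Qed.
Next Obligation.
move=> M N P g f m l [n /hom_graded[s [h [h' [us hh em en]]]]].
move=> /hom_graded[t [g1 [g2 [ut hg en' el]]]].
have e d := gr_unique us ut (fun d => let: And3 _ b _ := hh d in b)
  (fun d => let: And3 a _ _ := hg d in a) (etrans (esym en) en') d.
pose r := undup (s ++ t); have ur : uniq r by exact: undup_uniq.
have sr : {subset s <= r} by move=> d ds; rewrite mem_undup mem_cat ds.
have tr : {subset t <= r} by move=> d dt; rewrite mem_undup mem_cat dt orbT.
exists r, (fun d => if d \in s then h d else 0),
  (fun d => if d \in t then g2 d else 0); split=> //.
- move=> d; have [h1 h2 h3] := hh d; have [k1 k2 k3] := hg d; split.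
  + by case: ifP => _ //; apply: gr_comp0.
  + by case: ifP => _ //; apply: gr_comp0.
  + exists (if d \in s then h' d else 0).
      by case: ifP => _ //; apply: hom0.
    by rewrite e; case: ifP => _ //; apply: hom0.
- by rewrite em; apply: gr_extend.
- by rewrite el; apply: gr_extend.
Qed.
Next Obligation.
move=> M N P g f; have [sf hf] := hom_dom f; have [tg hg] := hom_dom g.
have [|s sP] := linrel_preim (@hom_klin _ _ f) (hom_dom_ksubspace g) (t := tg).
  by move=> m n _; apply: hg.
exists (s ++ sf) => u; have [w [n wn] sw] := hf u.
have [m' [n' [fm [l gn] sm]]] := sP _ _ wn.
exists m'; first by exists l, n'.
by rewrite -[u - m'](subrKA w) addrC; apply: spanned_cat.
Qed.
Next Obligation.
move=> M N P g f; have [s hs] := hom_ind f.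
have [t ht] := linrel_image (@hom_klin _ _ g) s (hom_ind g).
by exists t => l [n /hs fn gn]; apply: ht; exists n.
Qed.

Definition hlin_rel M N (c : k) (f g : hom M N) (m : M) (n : N) : Prop :=
  exists n1 n2, [/\ f m n1, g m n2 & n = mpolyC 2 c *: n1 + n2].

Program Definition hlin M N (c : k) (f g : hom M N) : hom M N :=
  @Hom M N (hlin_rel c f g) _ _ _ _ _.
Next Obligation.
by move=> M N c f g; exists 0, 0; rewrite scaler0 addr0; split=> //; apply: hom0.
Qed.
Next Obligation.
move=> M N c f g a m n m' n' [n1 [n2 [h1 h2 ->]]] [n3 [n4 [h3 h4 ->]]].
exists (a *: n1 + n3), (a *: n2 + n4); split; do ?exact: hom_lin.
by rewrite !scalerDr !scalerA mulrC addrACA.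
Qed.
Next Obligation.
move=> M N c f g m n [n1 [n2 [/hom_graded[s [h [h' [us hh em en]]]]]]].
move=> /hom_graded[t [g1 [g2 [ut hg em' en2]]]] ->.
have e d := gr_unique us ut (fun d => let: And3 a _ _ := hh d in a)
  (fun d => let: And3 a _ _ := hg d in a) (etrans (esym em) em') d.
pose r := undup (s ++ t); have ur : uniq r by exact: undup_uniq.
have sr : {subset s <= r} by move=> d ds; rewrite mem_undup mem_cat ds.
have tr : {subset t <= r} by move=> d dt; rewrite mem_undup mem_cat dt orbT.
exists r, (fun d => if d \in s then h d else 0),
  (fun d => mpolyC 2 c *: (if d \in s then h' d else 0)
            + (if d \in t then g2 d else 0)); split=> //.
- move=> d; have [h1 h2 h3] := hh d; have [k1 k2 k3] := hg d; split.
  + by case: ifP => _ //; apply: gr_comp0.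
  + apply: gr_compD; last by case: ifP => _ //; apply: gr_comp0.
    rewrite -[d in gr_comp d]addr0; apply: gr_compZ; first exact: homogC.
    by case: ifP => _ //; apply: gr_comp0.
  + exists (if d \in s then h' d else 0), (if d \in t then g2 d else 0).
    split=> //; first by case: ifP => _ //; apply: hom0.
    by rewrite e; case: ifP => _ //; apply: hom0.
- by rewrite em; apply: gr_extend.
- rewrite big_split /= -scaler_sumr en en2.
  by rewrite (gr_extend _ us ur sr) (gr_extend _ ut ur tr).
Qed.
Next Obligation.
move=> M N c f g; have [sf hf] := hom_dom f; have [tg hg] := hom_dom g.
pose G (m m' : M) := m = m' /\ exists n, f m n.
have Glin a m n m' n' : G m n -> G m' n' ->
    G (mpolyC 2 a *: m + m') (mpolyC 2 a *: n + n').
  move=> [-> [b hb]] [-> [b' hb']]; split=> //.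
  by exists (mpolyC 2 a *: b + b'); apply: hom_lin.
have [|s sP] := linrel_preim Glin (hom_dom_ksubspace g) (t := tg).
  by move=> m n _; apply: hg.
exists (s ++ sf) => u; have [w [n wn] sw] := hf u.
have [|m' [n' [[<- [n1 f1]] [n2 g2] sm]]] := sP w w; first by split=> //; exists n.
exists m'; first by exists (mpolyC 2 c *: n1 + n2), n1, n2.
by rewrite -[u - m'](subrKA w) addrC; apply: spanned_cat.
Qed.
Next Obligation.
move=> M N c f g; have [s hs] := hom_ind f; have [t ht] := hom_ind g.
exists (s ++ t) => _ [n1 [n2 [/hs h1 /ht h2 ->]]].
by apply: spanned_cat => //; apply: spannedZ.
Qed.

Definition isiso M N (f : hom M N) : Prop :=
  exists g : hom N M, homeq (hcomp g f) (idhom M) /\ homeq (hcomp f g) (idhom N).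

Definition iso M N : Prop := exists f : hom M N, isiso f.

Definition is_coker M N (f : hom M N) (C : grmod) : Prop :=
  exists c : hom N C, homnull (hcomp c f) /\
    forall Z (g : hom N Z), homnull (hcomp g f) ->
    exists h : hom C Z, homeq (hcomp h c) g /\
      forall h' : hom C Z, homeq (hcomp h' c) g -> homeq h' h.

Definition is_directsum (I : Type) (Xs : I -> grmod) (X : grmod) : Prop :=
  exists i_ : forall i, hom (Xs i) X,
    forall Z (g : forall i, hom (Xs i) Z),
    exists h : hom X Z, (forall i, homeq (hcomp h (i_ i)) (g i)) /\
      forall h' : hom X Z,
        (forall i, homeq (hcomp h' (i_ i)) (g i)) -> homeq h' h.

Record functor := Functor {
  fobj :> grmod -> grmod;
  fmap : forall M N, hom M N -> hom (fobj M) (fobj N);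
  fmap_eq : forall M N (f g : hom M N), homeq f g -> homeq (fmap f) (fmap g);
  fmap_id : forall M, homeq (fmap (idhom M)) (idhom (fobj M));
  fmap_comp : forall M N P (g : hom N P) (f : hom M N),
    homeq (fmap (hcomp g f)) (hcomp (fmap g) (fmap f))
}.

Definition nat_iso (F G : functor) : Prop :=
  exists eta : forall M, hom (F M) (G M), (forall M, isiso (eta M)) /\
    forall M N (f : hom M N),
      homeq (hcomp (eta N) (fmap F f)) (hcomp (fmap G f) (eta M)).

Lemma homeq_refl M N (f : hom M N) : homeq f f.
Proof.
have [s hs] := hom_ind f; exists s => u [m [n [n' [fn fn' ->]]]]; apply: hs.
have := hom_lin (-1) fn' fn.
by rewrite !scaleN1r addNr addrC.
Qed.

Lemma homeq_sub M N (f g : hom M N) : (forall m n, f m n -> g m n) -> homeq f g.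
Proof.
move=> fg; have [s hs] := homeq_refl g; exists s => u [m [n [n' [fn gn ->]]]].
by apply: hs; exists m, n, n'; split=> //; apply: fg.
Qed.

Lemma homeq_trans M N (g f h : hom M N) : homeq f g -> homeq g h -> homeq f h.
Proof.
move=> [s1 h1] [s2 h2]; have [tg hg] := hom_dom g.
pose R m u := exists n n', [/\ f m n, h m n' & u = n - n'].
have Rlin c m u m' u' : R m u -> R m' u' ->
    R (mpolyC 2 c *: m + m') (mpolyC 2 c *: u + u').
  move=> [a [b [fa hb ->]]] [a' [b' [fa' hb' ->]]].
  exists (mpolyC 2 c *: a + a'), (mpolyC 2 c *: b + b').
  by split; do ?exact: hom_lin; rewrite scalerBr opprD addrACA.
pose G (m m' : M) := m = m' /\ exists u, R m u.
have Glin c m n m' n' : G m n -> G m' n' ->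
    G (mpolyC 2 c *: m + m') (mpolyC 2 c *: n + n').
  move=> [-> [b hb]] [-> [b' hb']]; split=> //.
  by exists (mpolyC 2 c *: b + b'); apply: Rlin.
have [|s sP] := linrel_preim Glin (hom_dom_ksubspace g) (t := tg).
  by move=> m n _; apply: hg.
have [|t ht] := linrel_image Rlin s.
  have [sf hf] := hom_ind f; have [sh hh] := hom_ind h.
  exists (sf ++ sh) => u [a [b [/hf fa /hh hb ->]]]; apply: spanned_cat => //.
  by rewrite -scaleN1r -mpolyC1 -mpolyCN; apply: spannedZ.
exists (t ++ (s1 ++ s2)) => u [m [n [n' [fn hn eu]]]].
have Rmu : R m u by exists n, n'.
have [|m' [_ [[<- [v Rv]] [l gl] sm]]] := sP m m; first by split=> //; exists u.
have [a [b [fa hb ev]]] := Rv; rewrite -[u](subrK v); apply: spanned_cat.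
  apply: ht; exists (m - m') => //.
  have := Rlin (-1) _ _ _ _ Rv Rmu.
  by rewrite mpolyCN mpolyC1 !scaleN1r ![- _ + _]addrC.
have -> : v = (a - l) + (l - b) by rewrite addrA subrK.
apply: spanned_cat; first by apply: h1; exists m', a, l.
by apply: h2; exists m', l, b.
Qed.

Definition idfunctor : functor :=
  @Functor id (fun _ _ f => f) (fun _ _ _ _ h => h)
    (fun M => homeq_refl _) (fun _ _ _ _ _ => homeq_refl _).

Program Definition fcomp (G F : functor) : functor :=
  @Functor (fun M => G (F M)) (fun _ _ f => fmap G (fmap F f)) _ _ _.
Next Obligation. by move=> G F M N f g fg; do 2!apply: fmap_eq. Qed.
Next Obligation.
by move=> G F M; apply: homeq_trans (fmap_id G _); apply/fmap_eq/fmap_id.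
Qed.
Next Obligation.
move=> G F M N P g f; apply: homeq_trans (fmap_comp G _ _); apply: fmap_eq.
exact: fmap_comp.
Qed.

Record autoequiv := Autoequiv {
  ae_fun :> functor;
  ae_linear : forall M N c (f g : hom M N),
    homeq (fmap ae_fun (hlin c f g)) (hlin c (fmap ae_fun f) (fmap ae_fun g));
  ae_equiv : exists G : functor,
    nat_iso (fcomp G ae_fun) idfunctor /\ nat_iso (fcomp ae_fun G) idfunctor
}.

Program Definition shift_obj (y : L) (M : grmod) : grmod :=
  @GrMod M (fun d => gr_comp (y + d)) _ _ _ _ _ (gr_fg M).
Next Obligation. by move=> y M d; apply: gr_comp0. Qed.
Next Obligation. by move=> y M d u v; apply: gr_compD. Qed.
Next Obligation. by move=> y M d e f u hf hu /=; rewrite addrA; apply: gr_compZ. Qed.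
Next Obligation.
move=> y M u; have [s [h [us hh ->]]] := gr_decomp u.
exists [seq d - y | d <- s], (fun d => h (y + d)); split=> //.
  by rewrite map_inj_uniq //; apply: addIr.
by rewrite big_map; apply: eq_bigr => d _; rewrite addrC subrK.
Qed.
Next Obligation.
move=> y M s h us hh e d ds.
have := @gr_direct M [seq d' + y | d' <- s] (fun d' => h (d' - y)).
move=> /(_ _ _ _ (d + y)); rewrite addrK; apply.
- by rewrite map_inj_uniq //; apply: addIr.
- by move=> d'; have := hh (d' - y); rewrite addrC subrK.
- by rewrite big_map -[RHS]e; apply: eq_bigr => d' _; rewrite addrK.
- exact: map_f.
Qed.

Program Definition shift_hom y M N (f : hom M N) :
    hom (shift_obj y M) (shift_obj y N) :=
  @Hom (shift_obj y M) (shift_obj y N) (hrel f) (hom0 f) (@hom_lin _ _ f) _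
    (hom_dom f) (hom_ind f).
Next Obligation.
move=> y M N f m n /hom_graded[s [h [h' [us hh -> ->]]]].
exists [seq d - y | d <- s], (fun d => h (y + d)), (fun d => h' (y + d)).
split=> //.
- by rewrite map_inj_uniq //; apply: addIr.
- by move=> d; apply: hh.
- by rewrite big_map; apply: eq_bigr => d _; rewrite addrC subrK.
- by rewrite big_map; apply: eq_bigr => d _; rewrite addrC subrK.
Qed.

Definition gshift (y : L) : functor :=
  @Functor (shift_obj y) (shift_hom y) (fun _ _ _ _ h => h)
    (fun M => homeq_refl (idhom (shift_obj y M)))
    (fun _ _ _ g f => homeq_refl (hcomp (shift_hom y g) (shift_hom y f))).

Program Definition OX : grmod := @GrMod S^o homog homog0 homogD _ _ _ _.
Next Obligation. by move=> d e f u hf hu; rewrite addrC; apply: homogM. Qed.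
Next Obligation.
move=> f; pose h d := \sum_(m <- msupp f | mdegL m == d) mcoeff m f *: mpolyX k m.
exists (undup [seq mdegL m | m <- msupp f]), h; split; first exact: undup_uniq.
  move=> d; rewrite /h; elim/big_ind: _; [exact: homog0 | exact: homogD |].
  move=> m /eqP <-; rewrite -mul_mpolyC -[mdegL m]add0r.
  by apply: homogM; [apply: homogC | apply: homogX].
rewrite [LHS]mpolyE /h (exchange_big_dep xpredT) //=.
rewrite big_seq [RHS]big_seq; apply: eq_bigr => m mf.
rewrite -big_filter (_ : [seq _ <- _ | _] = [:: mdegL m]) ?big_seq1 //.
rewrite (eq_filter (a2 := pred1 (mdegL m))); last by move=> d; rewrite /= eq_sym.
by rewrite filter_pred1_uniq ?undup_uniq // mem_undup map_f.
Qed.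
Next Obligation.
move=> s h us hh e d ds; apply/mpolyP => m; rewrite mcoeff0.
have [mh|/memN_msupp_eq0 //] := boolP (m \in msupp (h d)).
have /(congr1 (mcoeff m)) := e; rewrite mcoeff0 raddf_sum (bigD1_seq d) //=.
rewrite big1_seq ?addr0 // => d' /andP[d'd _].
apply: memN_msupp_eq0; apply/negP => /hh ed'.
by rewrite -ed' (hh _ _ mh) eqxx in d'd.
Qed.
Next Obligation.
exists [:: 1 : S^o] => u; exists (fun=> u).
by rewrite big_ord_recl big_ord0 addr0; apply: esym; apply: mulr1.
Qed.

Definition OO (y : L) : grmod := shift_obj y OX.

Program Definition mulhom (y z : L) (f : S) (hf : homog (z - y) f) :
    hom (OO y) (OO z) :=
  @Hom (OO y) (OO z) (fun m n : S => n = f * m) _ _ _ _ _.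
Next Obligation. by move=> y z f hf; exact: (esym (mulr0 f)). Qed.
Next Obligation.
move=> y z f hf g m n m' n' -> ->.
suff: f * (g * (m : S) + (m' : S)) = g * (f * m) + f * m' by [].
by rewrite mulrDr mulrCA.
Qed.
Next Obligation.
move=> y z f hf m n ->; have [s [h [us hh em]]] := gr_decomp (m : OO y).
exists s, h, (fun d => f * (h d : S)); split=> //.
  move=> d; split=> //; have := homogM hf (hh d).
  by rewrite addrA subrK.
by rewrite em mulr_sumr.
Qed.
Next Obligation.
move=> y z f hf; exists [::] => u; exists u; first by exists (f * (u : S)).
by rewrite subrr; apply: spanned0.
Qed.
Next Obligation.
by move=> y z f hf; exists [::] => u /= ->; rewrite (mulr0 f); apply: spanned0.
Qed.

Lemma homog_var (i : 'I_2) (d : L) (j : nat) :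
  mdegL (mnm1 i) = d -> homog (d *+ j) (mpolyX k (mnm1 i) ^+ j).
Proof.
move=> <-; elim: j => [|j IHj]; first by rewrite expr0 -mpolyC1; apply: homogC.
by rewrite exprS mulrS; apply: homogM => //; apply: homogX.
Qed.

Lemma mdegL_x1 : mdegL (mnm1 0) = x1 p q.
Proof. by rewrite /mdegL !mnmE /= mulr0n mulr1n addr0. Qed.

Lemma mdegL_x2 : mdegL (mnm1 1) = x2 p q.
Proof. by rewrite /mdegL !mnmE /= mulr0n mulr1n add0r. Qed.

Lemma homog_x1 (i : int) (j : nat) :
  homog (x1 p q *~ i - x1 p q *~ (i - j%:Z)) (mpolyX k (mnm1 0) ^+ j).
Proof. by rewrite mulrzBr opprB addrC subrK; apply/homog_var/mdegL_x1. Qed.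

Lemma homog_x2 (i : int) (j : nat) :
  homog (x2 p q *~ i - x2 p q *~ (i - j%:Z)) (mpolyX k (mnm1 1) ^+ j).
Proof. by rewrite mulrzBr opprB addrC subrK; apply/homog_var/mdegL_x2. Qed.

(* The uniserial sheaf of length j with top S_{oo,i} is the cokernel of
   x1^j : O((i - j) x1) -> O(i x1), whose filtration by the images of the
   O((i - l) x1), l <= j, is its unique composition series. *)
Definition is_Sinf (i : int) (j : nat) (X : grmod) : Prop :=
  is_coker (mulhom (@homog_x1 i j)) X.

Definition is_S0 (i : int) (j : nat) (X : grmod) : Prop :=
  is_coker (mulhom (@homog_x2 i j)) X.

End GradedModules.

Section Swap.
Variables (k : closedFieldType) (p q : nat).
Local Notation S := (polS k).
Local Notation L := (L p q).
Local Notation swapS := (msym (tperm (0 : 'I_2) 1)).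

Definition swapL (x : L) : L := Lmk p q (repr x).2 (repr x).1.

Lemma swapLE (e : p = q) (a b : int) : swapL (Lmk p q a b) = Lmk p q b a.
Proof.
apply/LmkP; have := reprK (Lmk p q a b); rewrite {1}[repr _]surjective_pairing.
move=> /LmkP[n [ea eb]]; exists (- n).
by rewrite ea eb e !mulNr opprK.
Qed.

Lemma swapLD (e : p = q) x y : swapL (x + y) = swapL x + swapL y.
Proof.
have [a [b ->]] := Lmk_surj x; have [a' [b' ->]] := Lmk_surj y.
by rewrite -LmkD !swapLE // -LmkD.
Qed.

Lemma swapLK (e : p = q) : involutive swapL.
Proof. by move=> x; have [a [b ->]] := Lmk_surj x; rewrite !swapLE. Qed.

Lemma swapSK : involutive (swapS : S -> S).
Proof. by move=> f; rewrite -msymMm tperm2 msym1m. Qed.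

Lemma swapSC c : swapS (mpolyC 2 c) = mpolyC 2 c :> S.
Proof. by rewrite -[mpolyC _ _]mulr1 mul_mpolyC msymZ msym1. Qed.

Definition twist (V : lmodType S) : Type := V.
HB.instance Definition _ (V : lmodType S) := GRing.Zmodule.on (twist V).

Section Twist.
Variable V : lmodType S.
Definition tscale (f : S) (v : twist V) : twist V := swapS f *: (v : V).
Fact tscaleA f g v : tscale f (tscale g v) = tscale (f * g) v.
Proof. by rewrite /tscale scalerA msymM. Qed.
Fact tscale1 : left_id 1 tscale.
Proof. by move=> v; rewrite /tscale msym1 scale1r. Qed.
Fact tscaleDr : right_distributive tscale +%R.
Proof. by move=> f u v; rewrite /tscale scalerDr. Qed.
Fact tscaleDl v : {morph tscale^~ v : f g / f + g}.
Proof. by move=> f g; rewrite /tscale msymD scalerDl. Qed.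
HB.instance Definition _ := GRing.Zmodule_isLmodule.Build S (twist V)
  tscaleA tscale1 tscaleDr tscaleDl.
End Twist.

Lemma LmkMn (a b : int) n : Lmk p q a b *+ n = Lmk p q (a *+ n) (b *+ n).
Proof.
elim: n => [|n IHn]; last by rewrite !mulrS IHn -LmkD.
by apply: (addrI (Lmk p q 0 0)); rewrite addr0 -LmkD !mulr0n !addr0.
Qed.

Lemma homog_swap (e : p = q) (d : L) (f : S) :
  homog d f -> homog (swapL d) (swapS f).
Proof.
move=> hf m; rewrite mcoeff_msupp mcoeff_sym -mcoeff_msupp => /hf <-.
rewrite /mdegL /x1 /x2 !LmkMn -!LmkD swapLE // !mnmE tpermL tpermR.
by rewrite !mul0rn !addr0 !add0r.
Qed.

Lemma twist_spanned (V : lmodType S) (s : seq V) :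
  spanned (s : seq (twist V)) = spanned s.
Proof.
apply/seteqP; split=> u [c ->]; exists c; apply: eq_bigr => i _.
  by rewrite /GRing.scale /= /tscale swapSC.
by rewrite [RHS]/GRing.scale /= /tscale swapSC.
Qed.

Lemma twist_findim (V : lmodType S) (W : set V) :
  findim W -> findim (W : set (twist V)).
Proof. by move=> [s sP]; exists s; rewrite twist_spanned. Qed.

Lemma twist_fincodim (V : lmodType S) (W : set V) :
  fincodim W -> fincodim (W : set (twist V)).
Proof. by move=> [s sP]; exists s => u; rewrite twist_spanned; apply: sP. Qed.

Program Definition swap_obj (e : p = q) (M : grmod k p q) : grmod k p q :=
  @GrMod k p q (twist M) (fun d => gr_comp (swapL d)) _ _ _ _ _ _.
Next Obligation. by move=> e M d; apply: gr_comp0. Qed.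
Next Obligation. by move=> e M d u v; apply: gr_compD. Qed.
Next Obligation.
move=> e M d d' f u hf hu /=; rewrite swapLD //.
by apply: gr_compZ => //; apply: homog_swap.
Qed.
Next Obligation.
move=> e M u; have [s [h [us hh ->]]] := gr_decomp (u : M).
exists [seq swapL d | d <- s], (fun d => h (swapL d)); split=> //.
  by rewrite map_inj_uniq //; apply: inv_inj; apply: swapLK.
by rewrite big_map; apply: eq_bigr => d _; rewrite swapLK.
Qed.
Next Obligation.
move=> e M s h us hh e0 d ds.
have := @gr_direct _ _ _ M [seq swapL d' | d' <- s] (fun d' => h (swapL d')).
move=> /(_ _ _ _ (swapL d)); rewrite swapLK //; apply.
- by rewrite map_inj_uniq //; apply: inv_inj; apply: swapLK.
- by move=> d'; have := hh (swapL d'); rewrite /= swapLK.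
- by rewrite big_map -[RHS]e0; apply: eq_bigr => d' _; rewrite swapLK.
- exact: map_f.
Qed.
Next Obligation.
move=> e M; have [s sP] := gr_fg M; exists s => u; have [c ->] := sP u.
exists (fun i => swapS (c i)); apply: eq_bigr => i _.
by rewrite [RHS]/GRing.scale /= /tscale swapSK.
Qed.

Program Definition swap_hom (e : p = q) (M N : grmod k p q) (f : hom M N) :
    hom (swap_obj e M) (swap_obj e N) :=
  @Hom k p q (swap_obj e M) (swap_obj e N) (hrel f) (hom0 f) _ _
    (twist_fincodim (hom_dom f)) (twist_findim (hom_ind f)).
Next Obligation. by move=> e M N f c m n m' n' h h'; apply: hom_lin. Qed.
Next Obligation.
move=> e M N f m n /hom_graded[s [h [h' [us hh -> ->]]]].
exists [seq swapL d | d <- s], (fun d => h (swapL d)), (fun d => h' (swapL d)).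
split=> //.
- by rewrite map_inj_uniq //; apply: inv_inj; apply: swapLK.
- by move=> d; apply: hh.
- by rewrite big_map; apply: eq_bigr => d _; rewrite swapLK.
- by rewrite big_map; apply: eq_bigr => d _; rewrite swapLK.
Qed.

Definition sigma12 (e : p = q) : functor k p q :=
  @Functor k p q (swap_obj e) (@swap_hom e)
    (fun _ _ _ _ h => twist_findim h)
    (fun M => homeq_refl (idhom (swap_obj e M)))
    (fun _ _ _ g f => homeq_refl (hcomp (swap_hom e g) (swap_hom e f))).

End Swap.

Section Annulus.
Variables (R : realType) (p q : nat).

Definition strip : set (R * R) := [set z | 0 <= z.2 <= 1].

(* The quotient of the strip by (x, y) ~ (x + 1, y), realized as the cylinder
   S^1 x [0,1] in R^3 by the map [cover]. *)
Definition annulus : set (R * R * R) :=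
  [set w | w.1.1 ^+ 2 + w.1.2 ^+ 2 = 1 /\ 0 <= w.2 <= 1].

Definition cover (z : R * R) : R * R * R :=
  (cos (2 * pi * z.1), sin (2 * pi * z.1), z.2).

Definition inner (a : int) : R * R := (a%:~R / p%:R, 1).
Definition outer (b : int) : R * R := (b%:~R / q%:R, 0).

Definition marked : set (R * R * R) :=
  [set w | exists a, w = cover (inner a)] `|` [set w | exists b, w = cover (outer b)].

(* Curves are parametrized by [0,1]; their values elsewhere are irrelevant. *)
Definition curve (g : R -> R * R * R) : Prop :=
  {within `[0, 1], continuous g} /\ (forall t, 0 <= t <= 1 -> annulus (g t)).

Definition homotopic (g g' : R -> R * R * R) : Prop :=
  exists H : R * R -> R * R * R,
    [/\ {within `[0, 1] `*` `[0, 1], continuous H},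
        forall s t, 0 <= s <= 1 -> 0 <= t <= 1 -> annulus (H (s, t)),
        forall t, 0 <= t <= 1 -> H (0, t) = g t /\ H (1, t) = g' t &
        forall s, 0 <= s <= 1 -> H (s, 0) = g 0 /\ H (s, 1) = g 1].

(* The homotopy class in the annulus of the image of the curve [P,Q] *)
Definition arc_class (P Q : R * R) : set (R -> R * R * R) :=
  [set g | curve g /\ exists d : R -> R * R,
    [/\ {within `[0, 1], continuous d}, d 0 = P, d 1 = Q,
        forall t, 0 < t < 1 -> 0 < (d t).2 < 1 & homotopic (cover \o d) g]].

Definition bridging (i j : int) := arc_class (outer j) (inner i).
Definition per_inner (i j : int) := arc_class (inner i) (inner j).
Definition per_outer (i j : int) := arc_class (outer i) (outer j).

Definition oriented_class (c : set (R -> R * R * R)) : Prop :=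
  [\/ exists i j, c = bridging i j,
      exists i j, 2 <= j - i /\ c = per_inner i j |
      exists i j, 2 <= j - i /\ c = per_outer i j].

Definition simple_curve (g : R -> R * R * R) : Prop :=
  (forall t, 0 < t < 1 -> 0 < (g t).2 < 1) /\
  (forall t t', 0 < t < 1 -> 0 < t' < 1 -> g t = g t' -> t = t').

Definition is_arc (c : set (R -> R * R * R)) : Prop :=
  oriented_class c /\ exists2 g, c g & simple_curve g.

Definition noncrossing (c c' : set (R -> R * R * R)) : Prop :=
  exists g g', [/\ c g, c' g', simple_curve g, simple_curve g' &
    forall t t', 0 < t < 1 -> 0 < t' < 1 -> g t <> g' t'].

Definition compatible (Gamma : set (set (R -> R * R * R))) : Prop :=
  (forall c, Gamma c -> is_arc c) /\
  (forall c c', Gamma c -> Gamma c' -> c <> c' -> noncrossing c c').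

Definition triangulation (Gamma : set (set (R -> R * R * R))) : Prop :=
  compatible Gamma /\
  forall Gamma', compatible Gamma' -> Gamma `<=` Gamma' -> Gamma' `<=` Gamma.

Definition homeo (f : R * R * R -> R * R * R) : Prop :=
  exists g : R * R * R -> R * R * R,
    [/\ {within annulus, continuous f}, {within annulus, continuous g},
        (forall z, annulus z -> annulus (f z) /\ annulus (g z)) &
        forall z, annulus z -> g (f z) = z /\ f (g z) = z].

Definition is_lift (f : R * R * R -> R * R * R) (F : R * R -> R * R) : Prop :=
  {within strip, continuous F} /\
  forall z, strip z -> strip (F z) /\ cover (F z) = f (cover z).

(* A homeomorphism of the annulus preserves the orientation iff it preserves
   the induced orientation of the boundary, which is that of increasing x on
   the line y = 0 and that of decreasing x on the line y = 1.  Every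
   homeomorphism of the annulus has a lift to the strip. *)
Definition orientation_preserving (f : R * R * R -> R * R * R) : Prop :=
  exists2 F, is_lift f F &
    (forall x y, x < y ->
       [/\ (F (x, 0)).2 = 0, (F (x, 1)).2 = 1,
           (F (x, 0)).1 < (F (y, 0)).1 & (F (x, 1)).1 < (F (y, 1)).1]) \/
    (forall x y, x < y ->
       [/\ (F (x, 0)).2 = 1, (F (x, 1)).2 = 0,
           (F (y, 0)).1 < (F (x, 0)).1 & (F (y, 1)).1 < (F (x, 1)).1]).

Record mapping := Mapping {
  mg_fun :> R * R * R -> R * R * R;
  mg_homeo : homeo mg_fun;
  mg_marked : mg_fun @` marked = marked;
  mg_orientation : orientation_preserving mg_fun
}.

Definition isotopic_id (f : R * R * R -> R * R * R) : Prop :=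
  exists H : R * (R * R * R) -> R * R * R,
    [/\ {within `[0, 1] `*` annulus, continuous H},
        forall t, 0 <= t <= 1 -> homeo (fun z => H (t, z)),
        forall z, annulus z -> H (0, z) = z /\ H (1, z) = f z &
        forall t z, 0 <= t <= 1 -> marked z -> H (t, z) = z].

Definition is_r1 (f : mapping) : Prop :=
  exists2 F, is_lift f F & forall a : int,
    F (inner a) = inner (a + 1) /\ F (outer a) = outer a.

Definition is_r2 (f : mapping) : Prop :=
  exists2 F, is_lift f F & forall a : int,
    F (inner a) = inner a /\ F (outer a) = outer (a - 1).

Definition is_sigma (f : mapping) : Prop :=
  exists2 F, is_lift f F & forall a : int,
    F (inner a) = outer (- a) /\ F (outer a) = inner (- a).

Definition image_triangulation (f : mapping)
    (Gamma : set (set (R -> R * R * R))) : set (set (R -> R * R * R)) :=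
  [set c' | oriented_class c' /\ exists c g, [/\ Gamma c, c g &
    c' (f \o g) \/ c' (fun t => f (g (1 - t)))]].

End Annulus.

Section Correspondence.
Variables (R : realType) (k : closedFieldType) (p q : nat).

(* X is in the isomorphism class phi(c). *)
Definition phi (c : set (R -> R * R * R)) (X : grmod k p q) : Prop :=
  [\/ exists i j, c = bridging p q i j /\
        iso X (OO k (x1 p q *~ i - x2 p q *~ j)),
      exists i (j : nat), [/\ (0 < j)%N,
        c = per_inner p (i - j%:Z - 1) i & is_Sinf i j X] |
      exists i (j : nat), [/\ (0 < j)%N,
        c = per_outer q (- i) (j%:Z - i + 1) & is_S0 i j X]].

(* X is in the isomorphism class phi(Gamma). *)
Definition phi_sum (Gamma : set (set (R -> R * R * R))) (X : grmod k p q) : Prop :=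
  exists Xs : {c | Gamma c} -> grmod k p q,
    (forall c, phi (proj1_sig c) (Xs c)) /\ is_directsum Xs X.

(* psi is the group homomorphism from the mapping class group to the group of
   isomorphism classes of self-equivalences with the given values on the
   generators, as a function of representatives on both sides: [mapping] has
   the homeomorphisms, and psi_isotopic makes psi factor through the quotient
   by those isotopic to the identity.  The class r_1 (likewise r_2, sigma)
   consists of all f with is_r1 f. *)
Record is_psi (psi : mapping R p q -> autoequiv k p q) : Prop := IsPsi {
  psi_isotopic : forall h : mapping R p q, isotopic_id p q h ->
    nat_iso (psi h) (idfunctor k p q);
  psi_comp : forall f g h : mapping R p q,
    (forall z, annulus z -> h z = f (g z)) ->
    nat_iso (psi h) (fcomp (psi f) (psi g));
  psi_r1 : forall f : mapping R p q, is_r1 f -> nat_iso (psi f) (gshift k (x1 p q));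
  psi_r2 : forall f : mapping R p q, is_r2 f -> nat_iso (psi f) (gshift k (x2 p q));
  psi_sigma : forall (e : p = q) (f : mapping R p q), is_sigma f ->
    nat_iso (psi f) (sigma12 k e)
}.

End Correspondence.

(* Main.v *)
Require Import Defs.
From mathcomp Require Import all_boot all_order all_algebra.
From mathcomp Require Import all_classical all_reals.
From Stdlib Require Import -(notations) Setoid Morphisms.
From mathcomp Require Import perm all_analysis.
From mathcomp Require Import -(notations) mpoly.
From mathcomp Require Import ring lra zify.
(* [vector.hom] would otherwise shadow [Defs.hom]. *)
Import Defs.

(* A mapping class is only seen through its action on the marked points: a
   homeomorphism of the annulus preserving the marked points lifts to the strip,
   and by monotonicity on the boundary the lift translates the two sets of
   marked points by integers m and -n, or exchanges them after a reflection, in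
   which case p = q.  Composing with a rotation therefore turns any mapping into
   one in the class r_1 or sigma, on which psi is prescribed; hence psi(f) is the
   shift by m x_1 + n x_2, preceded by sigma_{1,2} in the second case, and no
   isotopy has to be constructed.

   On the side of curves, homotopies in the annulus lift to the strip, so that
   the class of the image of [P,Q] consists of the curves having a lift from P
   to Q; two classes meet iff their endpoints differ by a deck transformation,
   and f sends the class of [P,Q] to that of [F P, F Q] for a lift F.

   On the side of sheaves, the claim is checked on each indecomposable summand.
   The torsion sheaf S_{oo,i}^(j) is the cokernel of x_1^j on O(i x_1), and
   replacing i x_1 by i x_1 + b x_2 does not change this cokernel: as x_1^j and
   x_2^b form a regular sequence with finite dimensional quotient, the square of
   multiplications by x_1^j and x_2^b is a pushout in coh-X.  Equivalences
   preserve cokernels and direct sums. *)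

Set Implicit Arguments.
Unset Strict Implicit.
Unset Printing Implicit Defensive.

Import Order.TTheory GRing.Theory Num.Theory.
Import numFieldNormedType.Exports.

Local Open Scope classical_set_scope.
Local Open Scope ring_scope.

(** * The category coh-X *)

Section Hom.
Variables (k : closedFieldType) (p q : nat).
Implicit Types M N P Q Z : grmod k p q.

Lemma findim_sub (M : lmodType (polS k)) (A B : set M) :
  A `<=` B -> findim B -> findim A.
Proof. by move=> AB [s sP]; exists s; apply: subset_trans AB sP. Qed.

Lemma homeq_sym M N (f g : hom M N) : homeq f g -> homeq g f.
Proof.
move=> [s sP]; exists s => _ [m [n [n' [gn fn' ->]]]].
rewrite -opprB -scaleN1r -mpolyC1 -mpolyCN; apply/spannedZ/sP.
by exists m, n', n.
Qed.

#[export] Instance homeq_equiv M N : Equivalence (@homeq k p q M N).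
Proof.
split=> [f|f g|f g h]; first exact: homeq_refl.
  exact: homeq_sym.
exact: homeq_trans.
Qed.

#[local] Hint Resolve homeq_refl : core.

(** Padding both decompositions by zero on the union of their degree sets gives one index set [r],
    so that two graphs can be split degree by degree simultaneously. *)
Lemma hom_graded2 M N M' N' (f : hom M N) (g : hom M' N') m n m' n' :
  f m n -> g m' n' ->
  exists (r : seq (L p q)) (h : L p q -> M) (h' : L p q -> N)
    (e : L p q -> M') (e' : L p q -> N'),
  [/\ uniq r,
      forall d, [/\ gr_comp d (h d), gr_comp d (h' d) & f (h d) (h' d)],
      forall d, [/\ gr_comp d (e d), gr_comp d (e' d) & g (e d) (e' d)],
      m = \sum_(d <- r) h d /\ n = \sum_(d <- r) h' d &
      m' = \sum_(d <- r) e d /\ n' = \sum_(d <- r) e' d].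
Proof.
move=> /hom_graded[s [h [h' [us hh em en]]]].
move=> /hom_graded[t [g1 [g2 [ut hg em' en']]]].
pose r := undup (s ++ t); have ur : uniq r by exact: undup_uniq.
have sr : {subset s <= r} by move=> d ds; rewrite mem_undup mem_cat ds.
have tr : {subset t <= r} by move=> d dt; rewrite mem_undup mem_cat dt orbT.
exists r, (fun d => if d \in s then h d else 0),
  (fun d => if d \in s then h' d else 0), (fun d => if d \in t then g1 d else 0),
  (fun d => if d \in t then g2 d else 0); split=> //.
- move=> d; have [h1 h2 h3] := hh d.
  by case: ifP => _; split=> //; do ?exact: gr_comp0; apply: hom0.
- move=> d; have [h1 h2 h3] := hg d.
  by case: ifP => _; split=> //; do ?exact: gr_comp0; apply: hom0.
- by rewrite em en; split; apply: gr_extend.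
- by rewrite em' en'; split; apply: gr_extend.
Qed.

(** The sum of the two graphs is a common extension. Its indeterminacy at 0 consists of differences
    of values of [f] and [g] at one point, which is finite dimensional because [f] and [g] are
    identified. This turns [homeq] into containment of graphs. *)
Lemma homeq_sup M N (f g : hom M N) : homeq f g ->
  exists e : hom M N, (forall m n, f m n -> e m n) /\ (forall m n, g m n -> e m n).
Proof.
move=> [s sP].
pose e m n := exists m1 n1 m2 n2,
  [/\ f m1 n1, g m2 n2, m = m1 + m2 & n = n1 + n2].
have e0 : e 0 0 by exists 0, 0, 0, 0; split; rewrite ?addr0 //; apply: hom0.
have elin (c : polS k) m n m' n' : e m n -> e m' n' -> e (c *: m + m') (c *: n + n').
  move=> [m1 [n1 [m2 [n2 [h1 h2 -> ->]]]]] [m3 [n3 [m4 [n4 [h3 h4 -> ->]]]]].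
  exists (c *: m1 + m3), (c *: n1 + n3), (c *: m2 + m4), (c *: n2 + n4).
  by split; do ?exact: hom_lin; rewrite scalerDr addrACA.
have fe m n : f m n -> e m n.
  by move=> fmn; exists m, n, 0, 0; split; rewrite ?addr0 //; apply: hom0.
have ge m n : g m n -> e m n.
  by move=> gmn; exists 0, 0, m, n; split; rewrite ?add0r //; apply: hom0.
have egr m n : e m n -> exists (s : seq (L p q)) (h : L p q -> M) (h' : L p q -> N),
    [/\ uniq s,
        forall d, [/\ gr_comp d (h d), gr_comp d (h' d) & e (h d) (h' d)],
        m = \sum_(d <- s) h d & n = \sum_(d <- s) h' d].
  move=> [m1 [n1 [m2 [n2 [h1 h2 -> ->]]]]].
  have [r [h [h' [i [i' [ur H I [-> ->] [-> ->]]]]]]] := hom_graded2 h1 h2.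
  exists r, (fun d => h d + i d), (fun d => h' d + i' d); split=> //.
  - move=> d; have [a b c] := H d; have [a' b' c'] := I d.
    split; do ?exact: gr_compD.
    by exists (h d), (h' d), (i d), (i' d).
  - by rewrite big_split.
  - by rewrite big_split.
have edom : fincodim [set m | exists n, e m n].
  have [t tP] := hom_dom f; exists t => u; have [w [n fw] tw] := tP u.
  by exists w => //; exists n; apply: fe.
have eind : findim [set n | e 0 n].
  exists s => n [m1 [n1 [m2 [n2 [f1 g2 e1 ->]]]]]; apply: sP.
  (* Since [m1 + m2 = 0], negating the second pair puts both values over the same point [m1]. *)
  have := hom_lin (-1) g2 (hom0 g); rewrite !scaleN1r !addr0 => g2'.
  exists m1, n1, (- n2); split=> //; last by rewrite opprK.
  by rewrite (_ : m1 = - m2) //; apply/eqP; rewrite -addr_eq0 -e1.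
by exists (Hom e0 elin egr edom eind).
Qed.

(** The composite of the common extensions contains both composites, so each of them equals it in
    the colimit. *)
#[export] Instance hcomp_proper M N P :
  Proper (respectful (@homeq k p q N P)
      (respectful (@homeq k p q M N) (@homeq k p q M P)))
    (@hcomp k p q M N P).
Proof.
move=> g g' /homeq_sup[e2 [ge g'e]] f f' /homeq_sup[e1 [fe f'e]].
apply: (@homeq_trans _ _ _ _ _ (hcomp e2 e1)).
  by apply: homeq_sub => m n [a /fe ? /ge ?]; exists a.
by apply/homeq_sym/homeq_sub => m n [a /f'e ? /g'e ?]; exists a.
Qed.

#[export] Instance fmap_proper (F : functor k p q) M N :
  Proper (respectful (@homeq k p q M N) (@homeq k p q (F M) (F N)))
    (@fmap k p q F M N).
Proof. by move=> f g; apply: fmap_eq. Qed.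

Lemma hcompA M N P Q (h : hom P Q) (g : hom N P) (f : hom M N) :
  homeq (hcomp h (hcomp g f)) (hcomp (hcomp h g) f).
Proof.
by apply: homeq_sub => m n [a [b fb ga] hn]; exists b => //; exists a.
Qed.

Lemma hcomp1f M N (f : hom M N) : homeq (hcomp (idhom N) f) f.
Proof. by apply: homeq_sub => m n [a fa <-]. Qed.

Lemma hcompf1 M N (f : hom M N) : homeq (hcomp f (idhom M)) f.
Proof. by apply: homeq_sub => m n [a <- fa]. Qed.

Section LinHom.
Variables (M N : grmod k p q) (phi : M -> N).
Hypothesis phi_lin : forall (c : polS k) m m', phi (c *: m + m') = c *: phi m + phi m'.
Hypothesis phi_gr : forall d m, gr_comp d m -> gr_comp d (phi m).

Fact linhom_subproof0 : 0 = phi 0.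
Proof.
have := phi_lin 1 0 0; rewrite !scale1r !addr0 => e; apply/esym/eqP.
by rewrite -(inj_eq (addrI (phi 0))) -e addr0.
Qed.

Lemma linhomD m m' : phi (m + m') = phi m + phi m'.
Proof. by rewrite -[m]scale1r phi_lin !scale1r. Qed.

Lemma linhom_sum (s : seq (L p q)) h :
  phi (\sum_(d <- s) h d) = \sum_(d <- s) phi (h d).
Proof. exact: (big_morph _ linhomD (esym linhom_subproof0)). Qed.

(** An honest graded homomorphism is the case of full domain and zero indeterminacy in the
    colimit. *)
Program Definition linhom : hom M N :=
  @Hom k p q M N (fun m n => n = phi m) linhom_subproof0 _ _ _ _.
Next Obligation. by move=> f m n m' n' -> ->; rewrite phi_lin. Qed.
Next Obligation.
move=> m n ->; have [s [h [us hh ->]]] := gr_decomp m.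
exists s, h, (fun d => phi (h d)); split=> // [d|]; last exact: linhom_sum.
by split=> //; apply: phi_gr.
Qed.
Next Obligation.
exists [::] => u; exists u; first by exists (phi u).
by rewrite subrr; apply: spanned0.
Qed.
Next Obligation.
by exists [::] => u /= ->; rewrite -linhom_subproof0; apply: spanned0.
Qed.

End LinHom.

Lemma linhom_iso M N (f : M -> N) (g : N -> M) flin fgr :
  cancel f g -> cancel g f -> (forall d n, gr_comp d n -> gr_comp d (g n)) ->
  isiso (@linhom M N f flin fgr).
Proof.
move=> fK gK ggr.
have glin (c : polS k) m m' : g (c *: m + m') = c *: g m + g m'.
  by apply: (can_inj fK); rewrite flin !gK.
exists (@linhom N M g glin ggr); split.
  by apply: homeq_sub => m n [a -> ->]; rewrite fK.
by apply: homeq_sub => m n [a -> ->]; rewrite gK.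
Qed.

Program Definition hzero M N : hom M N := @linhom M N (fun=> 0) _ _.
Next Obligation. by move=> M N c m m'; rewrite scaler0 addr0. Qed.
Next Obligation. by move=> M N d m _; apply: gr_comp0. Qed.

Lemma homnullE M N (f : hom M N) : homnull f <-> homeq f (hzero M N).
Proof.
split; apply: findim_sub => u.
  by move=> [m [n [n' [fn -> ->]]]]; exists m; rewrite subr0.
by move=> [m fu]; exists m, u, 0; split=> //; rewrite subr0.
Qed.

Lemma hcomp0f M N P (f : hom M N) : homeq (hcomp (hzero N P) f) (hzero M P).
Proof. by apply: homeq_sub => m n [a _ ->]. Qed.

Lemma hcompf0 M N P (f : hom N P) : homeq (hcomp f (hzero M N)) (hzero M P).
Proof.
apply/homeq_sym/homeq_sub => m n ->; exists 0 => //; exact: hom0.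
Qed.

Lemma hlinNf M N (f : hom M N) : homeq (hlin (-1) f f) (hzero M N).
Proof.
apply: homeq_trans (homeq_refl _); apply: (findim_sub _ (homeq_refl f)).
move=> u [m [n [n' [[n1 [n2 [f1 f2 ->]]] -> ->]]]]; exists m, n2, n1; split=> //.
by rewrite mpolyCN mpolyC1 scaleN1r subr0 addrC.
Qed.

Lemma hlinN_null M N (f g : hom M N) : homnull (hlin (-1) g f) <-> homeq f g.
Proof.
split; apply: findim_sub => u.
  move=> [m [n [n' [fn gn ->]]]]; exists m, n', n; split=> //.
  by rewrite mpolyCN mpolyC1 scaleN1r addrC.
move=> [m [n1 [n2 [g1 f2 ->]]]]; exists m, n2, n1; split=> //.
by rewrite mpolyCN mpolyC1 scaleN1r addrC.
Qed.

Lemma isiso_id M : isiso (idhom M).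
Proof. by exists (idhom M); rewrite !hcomp1f. Qed.

Lemma isiso_comp M N P (g : hom N P) (f : hom M N) :
  isiso g -> isiso f -> isiso (hcomp g f).
Proof.
move=> [g' [g'g gg']] [f' [f'f ff']]; exists (hcomp f' g'); split.
  by rewrite -hcompA (hcompA g') g'g hcomp1f.
by rewrite -hcompA (hcompA f) ff' hcomp1f.
Qed.

Lemma iso_refl M : iso M M.
Proof. by exists (idhom M); apply: isiso_id. Qed.

Lemma iso_sym M N : iso M N -> iso N M.
Proof. by move=> [f [g [gf fg]]]; exists g, f. Qed.

Lemma iso_trans N M P : iso M N -> iso N P -> iso M P.
Proof. by move=> [f fi] [g gi]; exists (hcomp g f); apply: isiso_comp. Qed.

Lemma isiso_epi M N P (f : hom M N) (a b : hom N P) :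
  isiso f -> homeq (hcomp a f) (hcomp b f) -> homeq a b.
Proof.
move=> [g [_ fg]] e; by rewrite -(hcompf1 a) -(hcompf1 b) -fg !hcompA e.
Qed.

Lemma isiso_mono M N P (f : hom N P) (a b : hom M N) :
  isiso f -> homeq (hcomp f a) (hcomp f b) -> homeq a b.
Proof.
move=> [g [gf _]] e; by rewrite -(hcomp1f a) -(hcomp1f b) -gf -!hcompA e.
Qed.

Definition arrow_iso M N M' N' (f : hom M N) (f' : hom M' N') :=
  exists (a : hom M M') (b : hom N N'),
    [/\ isiso a, isiso b & homeq (hcomp b f) (hcomp f' a)].

Lemma arrow_iso_trans M N M' N' M2 N2
    (f : hom M N) (f' : hom M' N') (f2 : hom M2 N2) :
  arrow_iso f f' -> arrow_iso f' f2 -> arrow_iso f f2.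
Proof.
move=> [a [b [ai bi e]]] [a' [b' [ai' bi' e']]].
exists (hcomp a' a), (hcomp b' b); split; do ?exact: isiso_comp.
by rewrite -hcompA e hcompA e' hcompA.
Qed.

Lemma is_coker_iso M N M' N' (f : hom M N) (f' : hom M' N') X :
  arrow_iso f f' -> is_coker f X -> is_coker f' X.
Proof.
move=> [a [b [ai [b' [b'b bb']] e]]] [c [cf cP]].
have e' : homeq (hcomp (hcomp b' f') a) f.
  by rewrite -hcompA -e hcompA b'b hcomp1f.
exists (hcomp c b'); split.
  apply/homnullE/(isiso_epi ai); rewrite -hcompA -hcompA (hcompA b') e'.
  by move/homnullE: cf => ->; rewrite hcomp0f.
move=> Z g gf; have [|h [hc hP]] := cP Z (hcomp g b).
  apply/homnullE; rewrite -hcompA e hcompA.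
  by move/homnullE: gf => ->; rewrite hcomp0f.
exists h; split; first by rewrite hcompA hc -hcompA bb' hcompf1.
move=> h' h'c; apply: hP.
by rewrite -h'c -!hcompA b'b hcompf1.
Qed.

Lemma is_coker_unique M N (f : hom M N) X Y :
  is_coker f X -> is_coker f Y -> iso X Y.
Proof.
move=> [c [cf cP]] [d [df dP]].
have [h [hc _]] := cP _ d df; have [h' [h'd _]] := dP _ c cf.
have [i [_ iP]] := cP _ c cf; have [j [_ jP]] := dP _ d df.
exists h, h'; split.
  rewrite (iP (idhom X)) ?hcomp1f; last by [].
  by apply: iP; rewrite -hcompA hc.
rewrite (jP (idhom Y)) ?hcomp1f; last by [].
by apply: jP; rewrite -hcompA h'd.
Qed.

Lemma is_directsum_unique I (Xs : I -> grmod k p q) X Y :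
  is_directsum Xs X -> is_directsum Xs Y -> iso X Y.
Proof.
move=> [c cP] [d dP].
have [h [hc _]] := cP _ d; have [h' [h'd _]] := dP _ c.
have [i [_ iP]] := cP _ c; have [j [_ jP]] := dP _ d.
exists h, h'; split.
  rewrite (iP (idhom X)) => [|u]; last by rewrite hcomp1f.
  by apply: iP => u; rewrite -hcompA hc.
rewrite (jP (idhom Y)) => [|u]; last by rewrite hcomp1f.
by apply: jP => u; rewrite -hcompA h'd.
Qed.

Lemma is_directsum_iso I (Xs : I -> grmod k p q) X Y :
  iso X Y -> is_directsum Xs X -> is_directsum Xs Y.
Proof.
move=> [f [f' [f'f ff']]] [c cP]; exists (fun i => hcomp f (c i)) => Z g.
have [h [hc hP]] := cP Z g; exists (hcomp h f'); split=> [i|h' h'c].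
  by rewrite -hcompA (hcompA f') f'f hcomp1f; apply: hc.
rewrite -(hcompf1 h') -ff' hcompA (hP (hcomp h' f)) => [|i]; first by [].
by rewrite -hcompA.
Qed.

Lemma is_directsum_reindex (I J : Type) (Xs : I -> grmod k p q)
    (Ys : J -> grmod k p q) X (b : J -> I) (c : I -> J) :
  cancel b c -> cancel c b -> (forall j, iso (Xs (b j)) (Ys j)) ->
  is_directsum Xs X -> is_directsum Ys X.
Proof.
move=> bK cK XY [i_ iP].
have [a aP] : exists a : forall j, hom (Xs (b j)) (Ys j), forall j, isiso (a j).
  by exists (fun j => projT1 (cid (XY j))) => j; apply: (projT2 (cid (XY j))).
have [a' a'P] : exists a' : forall j, hom (Ys j) (Xs (b j)), forall j,
    homeq (hcomp (a' j) (a j)) (idhom _) /\ homeq (hcomp (a j) (a' j)) (idhom _).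
  by exists (fun j => projT1 (cid (aP j))) => j; apply: (projT2 (cid (aP j))).
exists (fun j => hcomp (i_ (b j)) (a' j)) => Z g.
(* The family [g] is indexed by [J], but the universal property of [X] asks for one indexed by [I]:
   the component at [b (c i)] is transported along [cK i]. *)
pose g' i := eq_rect (b (c i)) (fun i => hom (Xs i) Z)
  (hcomp (g (c i)) (a (c i))) i (cK i).
have g'E j : g' (b j) = hcomp (g j) (a j).
  (* Once [c (b j)] is generalized and replaced by [j], the transport is along a loop, which proof
     irrelevance makes trivial. *)
  rewrite /g'; move: (c (b j)) (bK j) (cK (b j)) => j' ej; rewrite {}ej => E.
  by rewrite (Prop_irrelevance E erefl).
have [h [hi hP]] := iP Z g'; exists h; split=> [j|h' h'i].
  have [_ aa'] := a'P j.
  by rewrite hcompA hi g'E -hcompA aa' hcompf1.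
apply: hP => i; have [j ej] : exists j, b j = i by exists (c i).
rewrite -ej g'E -h'i -!hcompA; have [-> _] := a'P j.
by rewrite hcompf1.
Qed.

Lemma nat_iso_sym (F G : functor k p q) : nat_iso F G -> nat_iso G F.
Proof.
move=> [eta [ei en]].
have [eta' e'P] : exists eta' : forall M, hom (G M) (F M), forall M,
    homeq (hcomp (eta' M) (eta M)) (idhom _) /\
    homeq (hcomp (eta M) (eta' M)) (idhom _).
  by exists (fun j => projT1 (cid (ei j))) => j; apply: (projT2 (cid (ei j))).
exists eta'; split=> [M|M N f].
  by exists (eta M); have [] := e'P M.
have [e1 e2] := e'P M; have [e3 e4] := e'P N.
apply: (isiso_mono (ei N)); apply: (isiso_epi (ei M)).
by rewrite hcompA e4 hcomp1f -!hcompA e1 hcompf1 en.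
Qed.

Lemma nat_iso_trans (F G H : functor k p q) :
  nat_iso F G -> nat_iso G H -> nat_iso F H.
Proof.
move=> [e [ei en]] [d [di dn]]; exists (fun M => hcomp (d M) (e M)).
split=> [M|M N f]; first exact: isiso_comp.
by rewrite -hcompA en hcompA dn hcompA.
Qed.

Lemma isiso_fmap (F : functor k p q) M N (f : hom M N) :
  isiso f -> isiso (fmap F f).
Proof.
move=> [g [gf fg]]; exists (fmap F g).
split; apply: homeq_trans (fmap_id F _); apply: homeq_trans;
  by [apply/homeq_sym/fmap_comp | apply: fmap_eq].
Qed.

Lemma iso_fobj (F : functor k p q) M N : iso M N -> iso (F M) (F N).
Proof. by move=> [f fi]; exists (fmap F f); apply: isiso_fmap. Qed.

Lemma nat_iso_fobj (F G : functor k p q) M : nat_iso F G -> iso (F M) (G M).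
Proof. by move=> [e [ei _]]; exists (e M). Qed.

Lemma nat_iso_arrow (F G : functor k p q) M N (f : hom M N) :
  nat_iso F G -> arrow_iso (fmap F f) (fmap G f).
Proof. by move=> [e [ei en]]; exists (e M), (e N). Qed.

Lemma nat_iso_compl (H F G : functor k p q) :
  nat_iso F G -> nat_iso (fcomp H F) (fcomp H G).
Proof.
move=> [e [ei en]]; exists (fun M => fmap H (e M)); split=> [M|M N f].
  exact: (isiso_fmap H (ei M)).
apply: homeq_trans (homeq_sym (fmap_comp H (e N) (fmap F f))) _.
apply: homeq_trans (fmap_comp H (fmap G f) (e M)).
exact: fmap_eq.
Qed.

Lemma nat_iso_compr (H F G : functor k p q) :
  nat_iso F G -> nat_iso (fcomp F H) (fcomp G H).
Proof.
move=> [e [ei en]]; exists (fun M => e (H M)); split=> [M|M N f]; first exact: ei.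
exact: en.
Qed.

Lemma nat_iso_compA (F G H : functor k p q) :
  nat_iso (fcomp F (fcomp G H)) (fcomp (fcomp F G) H).
Proof.
exists (fun M => idhom _); split=> [M|M N f]; first exact: isiso_id.
by rewrite hcomp1f hcompf1.
Qed.

Lemma nat_iso_comp1f (F : functor k p q) : nat_iso (fcomp (idfunctor k p q) F) F.
Proof.
exists (fun M => idhom _); split=> [M|M N f]; first exact: isiso_id.
by rewrite hcomp1f hcompf1.
Qed.

(** * Equivalences preserve cokernels and direct sums *)

Section Equivalence.
Variables F G : functor k p q.
Hypothesis GF : nat_iso (fcomp G F) (idfunctor k p q).

Lemma equiv_faithful M N (f g : hom M N) :
  homeq (fmap F f) (fmap F g) -> homeq f g.
Proof.
have [e [ei en]] := GF => /(fmap_eq G) fg.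
have ef := en _ _ f; have eg := en _ _ g; rewrite /= in ef eg.
by apply: (isiso_epi (ei M)); rewrite -ef -eg fg.
Qed.

End Equivalence.

(* The adjunction bijection Hom(A, G Z) = Hom(F A, Z). *)
Lemma equiv_adjoint (F G : functor k p q) Z :
  nat_iso (fcomp G F) (idfunctor k p q) -> nat_iso (fcomp F G) (idfunctor k p q) ->
  exists T : forall A, hom A (G Z) -> hom (F A) Z,
  [/\ forall A f g, homeq (T A f) (T A g) <-> homeq f g,
      forall A g, exists f, homeq (T A f) g &
      forall A B (f : hom B (G Z)) (g : hom A B),
        homeq (T A (hcomp f g)) (hcomp (T B f) (fmap F g))].
Proof.
move=> GF FG.
have [d [di dn]] : exists d : forall M, hom (F (G M)) M, (forall M, isiso (d M)) /\
    forall M N (f : hom M N),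
      homeq (hcomp (d N) (fmap F (fmap G f))) (hcomp f (d M)) := FG.
have [e [ei en]] : exists e : forall M, hom (G (F M)) M, (forall M, isiso (e M)) /\
    forall M N (f : hom M N),
      homeq (hcomp (e N) (fmap G (fmap F f))) (hcomp f (e M)) := GF.
exists (fun A f => hcomp (d Z) (fmap F f)); split=> [A f g|A g|A B f g].
- split=> [/(isiso_mono (di Z))|/(fmap_eq F) ->]; last by [].
  exact: (equiv_faithful GF).
- have [d' [d'd dd']] := di Z; have [e' [e'e ee']] := ei A.
  (* Fullness of [F]: conjugating [G (d' g)] by the isomorphisms [e] gives a preimage of [d' g]. The
     equality is checked after applying [G], which is faithful as well. *)
  have eE := en _ _ (hcomp (hcomp (e (G Z)) (fmap G (hcomp d' g))) e').
  exists (hcomp (hcomp (e (G Z)) (fmap G (hcomp d' g))) e').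
  apply: (@homeq_trans _ _ _ _ _ (hcomp (d Z) (hcomp d' g))); last first.
    by rewrite hcompA dd' hcomp1f.
  apply: hcomp_proper => //.
  apply: (equiv_faithful FG); apply: (isiso_mono (ei _)).
  by rewrite eE -hcompA e'e hcompf1.
- by rewrite -hcompA; have -> := fmap_comp F f g.
Qed.

Section AutoEquiv.
Variable F : autoequiv k p q.

(** A linear functor preserves zero because zero is the combination -f + f. *)
Lemma autoequiv_zero M N : homeq (fmap F (hzero M N)) (hzero (F M) (F N)).
Proof.
apply: homeq_trans (hlinNf (fmap F (hzero M N))).
apply: homeq_trans (ae_linear F _ _ _).
apply: fmap_eq; apply: homeq_sym; exact: hlinNf.
Qed.

(** Maps from [F N] to [Z] correspond to maps from [N] to [G Z], compatibly with precomposition, so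
    the universal property of [X] tested against [G Z] is that of [F X] tested against [Z]. *)
Lemma autoequiv_coker M N (f : hom M N) X :
  is_coker f X -> is_coker (fmap F f) (F X).
Proof.
have [G [GF FG]] := ae_equiv F.
move=> [c [/homnullE cf cP]]; exists (fmap F c); split.
  apply/homnullE; have <- := fmap_comp F c f; have -> := fmap_eq F cf.
  exact: autoequiv_zero.
move=> Z g /homnullE gf; have [T [Teq Tsurj Tcomp]] := equiv_adjoint Z GF FG.
(* Only naturality of the bijection [T] is available: if [T z] is the zero map, then zero is also
   [T z] composed with [F 0], which is [T] of z composed with 0. *)
have T0 A : homeq (T A (hzero A (G Z))) (hzero (F A) Z).
  have [z zP] := Tsurj A (hzero (F A) Z).
  rewrite -[X in homeq _ X](hcomp0f Z (hzero (F A) (F A))) -zP -autoequiv_zero.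
  by rewrite -Tcomp; apply/Teq; rewrite hcompf0.
have [g' g'P] := Tsurj _ g.
have [|h [hc hP]] := cP _ g'.
  by apply/homnullE/Teq; rewrite T0 -gf -g'P Tcomp.
exists (T _ h); split; first by rewrite -Tcomp -g'P; apply/Teq.
move=> h1 h1c; have [h' h'P] := Tsurj _ h1; rewrite -h'P.
by apply/Teq/hP/Teq; rewrite Tcomp h'P h1c g'P.
Qed.

Lemma autoequiv_directsum I (Xs : I -> grmod k p q) X :
  is_directsum Xs X -> is_directsum (fun i => F (Xs i)) (F X).
Proof.
have [G [GF FG]] := ae_equiv F.
move=> [c cP]; exists (fun i => fmap F (c i)) => Z g.
have [T [Teq Tsurj Tcomp]] := equiv_adjoint Z GF FG.
have [g' g'P] : exists g' : forall i, hom (Xs i) (G Z), forall i,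
    homeq (T _ (g' i)) (g i).
  by exists (fun i => projT1 (cid (Tsurj _ (g i)))) => j;
    apply: (projT2 (cid (Tsurj _ (g j)))).
have [h [hc hP]] := cP _ g'; exists (T _ h); split=> [i|h1 h1c].
  by rewrite -Tcomp -g'P; apply/Teq.
have [h' h'P] := Tsurj _ h1; rewrite -h'P.
by apply/Teq/hP => i; apply/Teq; rewrite Tcomp h'P h1c g'P.
Qed.

End AutoEquiv.
End Hom.

(** * Shifts, the swap and cokernels of multiplications *)

Section Shift.
Variables (k : closedFieldType) (p q : nat).
Implicit Types (M N X : grmod k p q) (y z w : L p q).
#[local] Hint Resolve homeq_refl : core.

Section ShiftIso.
Variables (M N : grmod k p q) (y z w : L p q).
Hypothesis e : z + y = w.

(** The two gradings on the same module agree only up to associativity in L(p,q), so the identity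
    map is an isomorphism between distinct objects. Keeping [w] a variable admits any expression for
    the sum. *)
Program Definition shift_shift : hom (shift_obj y (shift_obj z M)) (shift_obj w M) :=
  @linhom k p q (shift_obj y (shift_obj z M)) (shift_obj w M) idfun _ _.
Next Obligation. by []. Qed.
Next Obligation. by move=> d m; rewrite /= -e addrA. Qed.

Lemma shift_shift_iso : isiso shift_shift.
Proof.
apply: (@linhom_iso _ _ _ (shift_obj y (shift_obj z M)) (shift_obj w M) idfun idfun) => //.
by move=> d n; rewrite /= -e addrA.
Qed.

End ShiftIso.

Lemma gshiftD y z w : z + y = w ->
  nat_iso (fcomp (gshift k y) (gshift k z)) (gshift k w).
Proof.
move=> e; exists (fun M => shift_shift M e); split=> [M|M N f].
  exact: shift_shift_iso.
by apply: homeq_sub => m n [a fa ->]; exists m.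
Qed.

Program Definition shift_zero M : hom (shift_obj 0 M) M :=
  @linhom k p q (shift_obj 0 M) M idfun _ _.
Next Obligation. by []. Qed.
Next Obligation. by move=> M d m; rewrite /= add0r. Qed.

Lemma gshift0 : nat_iso (gshift k (0 : L p q)) (idfunctor k p q).
Proof.
exists (fun M => shift_zero M); split=> [M|M N f].
  apply: (@linhom_iso _ _ _ (shift_obj 0 M) M idfun idfun) => //.
  by move=> d n; rewrite /= add0r.
by apply: homeq_sub => m n [a fa ->]; exists m.
Qed.

Lemma gshift_move (F G : functor k p q) y : nat_iso F (fcomp (gshift k y) G) ->
  nat_iso G (fcomp (gshift k (- y)) F).
Proof.
move=> h; apply: nat_iso_sym; apply: nat_iso_trans (nat_iso_compl _ h) _.
apply: nat_iso_trans (nat_iso_compA _ _ _) _.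
apply: nat_iso_trans (nat_iso_compr _ (gshiftD (subrr y))) _.
apply: nat_iso_trans (nat_iso_compr _ gshift0) _.
exact: nat_iso_comp1f.
Qed.

Lemma gshift_OO y z : iso (gshift k y (OO k z)) (OO k (y + z)).
Proof.
by rewrite addrC; exists (shift_shift _ erefl); apply: shift_shift_iso.
Qed.

Lemma gshift_mulhom w y z (f : polS k) (hf : homog (z - y) f)
    (hf' : homog (w + z - (w + y)) f) :
  arrow_iso (fmap (gshift k w) (mulhom hf)) (mulhom hf').
Proof.
exists (shift_shift (OX k p q) (addrC y w)), (shift_shift (OX k p q) (addrC z w)).
split; do ?exact: shift_shift_iso.
by apply: homeq_sub => m n [a -> ->]; exists m.
Qed.

(** Quantifying over the degree proof lets the degrees [y] and [z] be rewritten freely; proof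
    irrelevance identifies the different choices. *)
Definition mul_coker (f : polS k) y z X :=
  exists hf : homog (z - y) f, is_coker (mulhom hf) X.

Lemma mul_coker_unique f y z X X' : mul_coker f y z X -> mul_coker f y z X' -> iso X X'.
Proof.
by move=> [h hX] [h']; rewrite (Prop_irrelevance h' h); apply: is_coker_unique hX.
Qed.

Lemma gshift_mul_coker (F : autoequiv k p q) w f y z X :
  nat_iso F (gshift k w) -> mul_coker f y z X -> mul_coker f (w + y) (w + z) (F X).
Proof.
move=> Fw [h /(autoequiv_coker F) hX].
have h' : homog (w + z - (w + y)) f by rewrite opprD addrACA subrr add0r.
exists h'; apply: is_coker_iso hX.
exact: arrow_iso_trans (nat_iso_arrow _ Fw) (gshift_mulhom h h').
Qed.

Lemma Sinf_mul_coker i j X :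
  is_Sinf i j X <-> mul_coker (mpolyX k (mnm1 0) ^+ j)
    (x1 p q *~ (i - j%:Z)) (x1 p q *~ i) X.
Proof.
rewrite /is_Sinf; split=> [h|[h]]; first by eexists; exact: h.
by rewrite (Prop_irrelevance h (@homog_x1 k p q i j)).
Qed.

Lemma S0_mul_coker i j X :
  is_S0 i j X <-> mul_coker (mpolyX k (mnm1 1) ^+ j)
    (x2 p q *~ (i - j%:Z)) (x2 p q *~ i) X.
Proof.
rewrite /is_S0; split=> [h|[h]]; first by eexists; exact: h.
by rewrite (Prop_irrelevance h (@homog_x2 k p q i j)).
Qed.

End Shift.

Section Swap.
Variables (k : closedFieldType) (p q : nat) (e : p = q).
Local Notation swapS := (msym (tperm (0 : 'I_2) 1)).
Implicit Types (y z w : L p q) (X : grmod k p q).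

Section SwapOO.
Variable y : L p q.

(** Exchanging the variables is only semilinear on S; it becomes linear here because [sigma12]
    twists the scalar action by the same exchange. *)
Fact swap_OO_lin (c : polS k) (m m' : sigma12 k e (OO k y)) :
  swapS (c *: m + m') = c *: (swapS m : OO k (swapL y)) + swapS m'.
Proof.
rewrite msymD; congr (_ + _).
have -> : c *: m = swapS c * (m : polS k) by [].
by rewrite msymM swapSK.
Qed.

Fact swap_OO_gr d (m : sigma12 k e (OO k y)) :
  gr_comp d m -> gr_comp (g := OO k (swapL y)) d (swapS m).
Proof. by rewrite /= => /(homog_swap e); rewrite swapLD // swapLK. Qed.

Definition swap_OO : hom (sigma12 k e (OO k y)) (OO k (swapL y)) :=
  @linhom k p q (sigma12 k e (OO k y)) (OO k (swapL y)) swapS swap_OO_lin swap_OO_gr.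

Lemma swap_OO_iso : isiso swap_OO.
Proof.
apply: (@linhom_iso k p q (sigma12 k e (OO k y)) (OO k (swapL y)) swapS swapS).
- exact: swapSK.
- exact: swapSK.
- by move=> d n /= /(homog_swap e); rewrite swapLD // swapLK.
Qed.

End SwapOO.

Lemma sigma12_mulhom y z f (hf : homog (z - y) f)
    (hf' : homog (swapL z - swapL y) (swapS f)) :
  arrow_iso (fmap (sigma12 k e) (mulhom hf)) (mulhom hf').
Proof.
exists (swap_OO y), (swap_OO z); split; do ?exact: swap_OO_iso.
by apply: homeq_sub => m n [a -> ->]; exists (swapS m); rewrite //= msymM.
Qed.

Lemma sigma12_mul_coker (F : autoequiv k p q) w f y z X :
  nat_iso F (fcomp (gshift k w) (sigma12 k e)) -> mul_coker f y z X ->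
  mul_coker (swapS f) (w + swapL y) (w + swapL z) (F X).
Proof.
move=> Fw [h /(autoequiv_coker F) hX].
have h1 : homog (swapL z - swapL y) (swapS f).
  have := homog_swap e h; congr homog.
  by apply: (addIr (swapL y)); rewrite -swapLD // !subrK.
have h' : homog (w + swapL z - (w + swapL y)) (swapS f).
  by rewrite opprD addrACA subrr add0r.
exists h'; apply: is_coker_iso hX.
apply: arrow_iso_trans (nat_iso_arrow _ Fw) _.
have [a [b [ai bi ab]]] := sigma12_mulhom h h1.
apply: arrow_iso_trans (gshift_mulhom h1 h').
exists (fmap (gshift k w) a), (fmap (gshift k w) b).
split; do ?exact: isiso_fmap.
apply: homeq_trans (homeq_sym (fmap_comp (gshift k w) _ _)) _.
apply: homeq_trans (fmap_comp (gshift k w) _ _).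
exact: fmap_eq.
Qed.

End Swap.

(** * Pushout squares of multiplications between line bundles *)

Section Pushout.
Variables (k : closedFieldType) (p q : nat).
Variables (y z y' z' : L p q) (f g : polS k).
Hypotheses (hf : homog (z - y) f) (hf' : homog (z' - y') f).
Hypotheses (hg : homog (z' - z) g) (hg' : homog (y' - y) g).
Hypothesis g_regular : forall m l : polS k, g * m = f * l -> exists m', m = f * m'.
Hypothesis fg_cofinite :
  fincodim (M := (polS k)^o) [set u | exists m l, u = g * m + f * l].
#[local] Hint Resolve homeq_refl : core.

Lemma mulhom_commute :
  homeq (hcomp (mulhom hg) (mulhom hf)) (hcomp (mulhom hf') (mulhom hg')).
Proof. by apply: homeq_sub => m n [_ -> ->]; exists (g * m); rewrite //= mulrCA. Qed.

Lemma spanned_mul (h : polS k) (t : seq (polS k)^o) u :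
  spanned t u -> spanned ([seq h * x | x <- t] : seq (polS k)^o) (h * u).
Proof.
elim: t u => [|a t IHt] u; first by move=> /spanned_nil ->; rewrite mulr0; apply: spanned0.
move=> /spanned_cons[c [v [tv ->]]]; apply/spanned_cons; exists c, (h * v).
split; first exact: IHt.
by rewrite mulrDr; congr (_ + _); apply: mulrCA.
Qed.

(** The subspace gA + fB has finite codimension because S/(f,g), S/A and S/B are finite dimensional,
    and multiplication by g or f keeps the remainders in finite dimensional spaces. *)
Lemma fincodim_mul (A B : set (polS k)^o) : fincodim A -> fincodim B ->
  fincodim (M := (polS k)^o) [set u | exists m l, [/\ A m, B l & u = g * m + f * l]].
Proof.
move=> [s sP] [t tP]; have [r rP] := fg_cofinite.
exists (r ++ (([seq g * x | x <- s] : seq (polS k)^o) ++ [seq f * x | x <- t])) => u.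
have [_ [m [l ->]] ru] := rP u.
have [m1 Am sm] := sP m; have [l1 Bl tl] := tP l.
exists (g * m1 + f * l1); first by exists m1, l1.
have -> : u - (g * m1 + f * l1) =
    u - (g * m + f * l) + (g * (m - m1) + f * (l - l1)).
  by rewrite !mulrBr [X in _ = _ + X]addrACA -opprD addrA subrK.
by apply: spanned_cat => //; apply: spanned_cat; apply: spanned_mul.
Qed.

(** The two maps into O(z') are jointly epimorphic: [d] has finite dimensional image on gA + fB, and
    the finite dimensional complement contributes only finitely many more dimensions. *)
Lemma pushout_null Z (d : hom (OO k z') Z) :
  homnull (hcomp d (mulhom hg)) -> homnull (hcomp d (mulhom hf')) -> homnull d.
Proof.
move=> [s1 s1P] [s2 s2P].
have [r rP] := fincodim_mul (hom_dom (hcomp d (mulhom hg)))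
  (hom_dom (hcomp d (mulhom hf'))).
have [t tP] := linrel_image (@hom_klin _ _ _ _ _ d) r (hom_ind d).
exists (t ++ (s1 ++ s2)) => n [m dmn].
have [_ [a [b [[v1 [_ -> d1]] [v2 [_ -> d2]] ->]]] rm] := rP m.
have d12 : d (g * a + f * b) (v1 + v2).
  by have := hom_lin 1 d1 d2; rewrite !scale1r.
rewrite -[n](subrK (v1 + v2)); apply: spanned_cat.
  apply: tP; exists (m - (g * a + f * b)) => //.
  by have := hom_lin (-1) d12 dmn; rewrite !scaleN1r ![- _ + _]addrC.
by apply: spanned_cat; [apply: s1P; exists a, (g * a) | apply: s2P; exists b, (f * b)].
Qed.

Lemma pushout_unique Z (a b : hom (OO k z') Z) :
  homeq (hcomp a (mulhom hg)) (hcomp b (mulhom hg)) ->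
  homeq (hcomp a (mulhom hf')) (hcomp b (mulhom hf')) -> homeq a b.
Proof.
move=> /hlinN_null eg /hlinN_null ef; apply/hlinN_null/pushout_null.
  apply: (findim_sub _ eg) => u [m [n -> [n1 [n2 [b1 a2 ->]]]]].
  by exists m, n1, n2; split=> //; exists (g * m).
apply: (findim_sub _ ef) => u [m [n -> [n1 [n2 [b1 a2 ->]]]]].
by exists m, n1, n2; split=> //; exists (f * m).
Qed.

Section Extend.
Variables (Z : grmod k p q) (a : hom (OO k z) Z).
Hypothesis af : homnull (hcomp a (mulhom hf)).

(** The map out of the pushout given by [a] on O(z) and by zero on O(y'). It is defined only on a
    subspace of gS + fS of finite codimension, which suffices in the Serre quotient. *)
Definition extend_rel (x : OO k z') (u : Z) : Prop :=
  exists m l : polS k, x = g * m + f * l /\ a m u.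

Program Definition extend : hom (OO k z') Z :=
  @Hom k p q (OO k z') Z extend_rel _ _ _ _ _.
Next Obligation.
by exists 0, 0; split; [rewrite !mulr0 addr0 | apply: hom0].
Qed.
Next Obligation.
move=> c _ n _ n' [m [l [-> amn]]] [m' [l' [-> amn']]].
exists (c * m + m'), (c * l + l'); split; last exact: (hom_lin c amn).
suff: c * (g * m + f * l) + (g * m' + f * l') = g * (c * m + m') + f * (c * l + l').
  by [].
by rewrite !mulrDr !(mulrCA c) addrACA.
Qed.
Next Obligation.
move=> _ u [m [l [-> amu]]].
(* Pairing [a] with the identity of O(y') yields homogeneous decompositions of [m] and [l] over the
   same degrees. *)
have [r [h [h' [i [i' [ur H I [-> ->] [-> _]]]]]]] :=
  hom_graded2 amu (erefl : idhom (OO k y') l l).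
exists r, (fun d => g * (h d : polS k) + f * (i d : polS k)), h'; split=> //.
- move=> d; have [h1 h2 h3] := H d; have [i1 _ _] := I d; split=> //.
    apply: homogD; first by have := homogM hg h1; rewrite addrA subrK.
    by have := homogM hf' i1; rewrite addrA subrK.
  by exists (h d), (i d).
- by rewrite big_split /= -!mulr_sumr.
Qed.
Next Obligation.
have [r rP] := fincodim_mul (hom_dom a) (hom_dom (idhom (OO k y'))).
exists r => u; have [w [m [l [[n am] _ ->]]] ru] := rP u.
by exists (g * m + f * l) => //; exists n, m, l.
Qed.
Next Obligation.
(* If gm + fl = 0, regularity makes m a multiple of f, and [a] has finite dimensional image on
   those. *)
apply: findim_sub af => u [m [l [/esym/eqP]]].
rewrite addr_eq0 => /eqP; rewrite -mulrN => /g_regular[m' ->] amu.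
by exists m', (f * m').
Qed.

Lemma extend_g : homeq (hcomp extend (mulhom hg)) a.
Proof.
apply/homeq_sym/homeq_sub => m n amn; exists (g * m) => //.
by exists m, 0; rewrite mulr0 addr0.
Qed.

Lemma extend_f : homnull (hcomp extend (mulhom hf')).
Proof.
apply: findim_sub af => u [m [_ -> [m1 [l [/eqP]]]]].
rewrite -subr_eq -mulrBr => /eqP/esym/g_regular[m' ->] amu.
by exists m', (f * m').
Qed.

End Extend.

(** Opposite sides of a pushout square have the same cokernel: a cokernel map out of O(z) extends by
    zero along f to O(z'), and one out of O(z') restricts along g to O(z). *)
Lemma mul_coker_pushout X : mul_coker f y z X <-> mul_coker f y' z' X.
Proof.
split=> [[h]|[h]].
  rewrite (Prop_irrelevance h hf) => -[c [cf cP]]; exists hf'.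
  have c'g := extend_g cf; have c'f := extend_f cf; set c' := extend cf in c'g c'f.
  exists c'; split=> // Z a af; have [|b [bc bP]] := cP Z (hcomp a (mulhom hg)).
    apply/homnullE; rewrite -hcompA mulhom_commute hcompA.
    by move/homnullE: af => ->; rewrite hcomp0f.
  exists b; split.
    apply: pushout_unique; first by rewrite -hcompA c'g.
    move/homnullE: c'f => c'f; move/homnullE: af => ->.
    by rewrite -hcompA c'f hcompf0.
  by move=> b' b'c; apply: bP; rewrite -c'g hcompA b'c.
rewrite (Prop_irrelevance h hf') => -[c [cf cP]]; exists hf.
exists (hcomp c (mulhom hg)); split.
  apply/homnullE; rewrite -hcompA mulhom_commute hcompA.
  by move/homnullE: cf => ->; rewrite hcomp0f.
move=> Z a af; have a'g := extend_g af; have a'f := extend_f af.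
set a' := extend af in a'g a'f; have [b [bc bP]] := cP Z a' a'f; exists b; split.
  by rewrite hcompA bc.
move=> b' b'c; apply: bP; apply: pushout_unique; first by rewrite -hcompA a'g.
move/homnullE: a'f => ->; rewrite -hcompA; move/homnullE: cf => ->.
by rewrite hcompf0.
Qed.

End Pushout.

(** * Powers of the two variables form a regular sequence with finite dimensional quotient *)

Section Monomials.
Variable k : closedFieldType.
Implicit Types (i j : 'I_2) (a b : nat).
Local Notation var i := (mpolyX k (mnm1 i)).

(** Multiplying by a power of [var i] does not change the exponent of [var j], so every monomial of
    [m] is already divisible by [var j ^+ b]. *)
Lemma var_regular i j a b (m l : polS k) : i != j ->
  var i ^+ a * m = var j ^+ b * l -> exists m', m = var j ^+ b * m'.
Proof.
move=> ij; rewrite !mpolyXn => e.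
have le_supp u : u \in msupp m -> (b <= u j)%N.
  rewrite mcoeff_msupp -(mcoeffMX m (mnm_muln (mnm1 i) a)).
  rewrite commr_mpolyX e -commr_mpolyX -mcoeff_msupp.
  rewrite (perm_mem (msuppMX _ _)) => /mapP[v _ /mnmP/(_ j)].
  rewrite !mnmDE !mulmnE !mnm1E (negbTE ij) eqxx /= mul0n mul1n add0n => ->.
  exact: leq_addr.
(* The quotient lowers the exponent of [var j] by [b] in each monomial of [m]. *)
exists (\sum_(u <- msupp m) mcoeff u m *: mpolyX k (mnm_sub u (mnm_muln (mnm1 j) b))).
rewrite {1}[m]mpolyE mulr_sumr big_seq [RHS]big_seq; apply: eq_bigr => u /le_supp bu.
rewrite -scalerAr -mpolyXD; congr (_ *: mpolyX k _); apply/mnmP => v.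
rewrite mnmDE mnmBE !mulmnE !mnm1E; case: eqVneq => [<-|_]; rewrite ?mul0n ?subn0 //.
by rewrite mul1n subnKC.
Qed.

(** The quotient is spanned by the monomials with exponents below [a] and [b], listed in [t]; every
    other monomial lies in the ideal. *)
Lemma var_cofinite i j a b : i != j ->
  fincodim (M := (polS k)^o) [set u | exists m l, u = var i ^+ a * m + var j ^+ b * l].
Proof.
move=> ij; pose t : seq (polS k)^o := [seq var i ^+ c * var j ^+ d | c <- iota 0 a, d <- iota 0 b].
exists t; elim/mpolyind => [|c u v _ _ [_ [m [l ->]] tv]].
  by exists 0; [exists 0, 0; rewrite !mulr0 addr0 | rewrite subrr; apply: spanned0].
suff [m' [l' tu]] : exists m l, spanned t (mpolyX k u - (var i ^+ a * m + var j ^+ b * l)).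
  have := spanned_lin c tu tv; rewrite -mul_mpolyC; set C := mpolyC 2 c.
  exists (var i ^+ a * (C * m' + m) + var j ^+ b * (C * l' + l)).
    by exists (C * m' + m), (C * l' + l).
  rewrite (_ : _ - _ = C * (mpolyX k u - (var i ^+ a * m' + var j ^+ b * l')) +
    (v - (var i ^+ a * m + var j ^+ b * l))) //.
  by ring.
have eu : mpolyX k u = var i ^+ u i * var j ^+ u j.
  rewrite !mpolyXn -mpolyXD; congr mpolyX; apply/mnmP => v'.
  rewrite mnmDE !mulmnE !mnm1E.
  (* There are only two variables, so the distinct indices [i] and [j] exhaust them. *)
  have : (v' == i) || (v' == j).
    by move: i j v' ij {t tv} => [[|[|//]] ?] [[|[|//]] ?] [[|[|//]] ?].
  by case/orP => /eqP ->; rewrite eqxx ?(negbTE ij) 1?eq_sym ?(negbTE ij) !mul0n mul1n ?addn0.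
have [ai|ai] := leqP a (u i).
  exists (var i ^+ (u i - a) * var j ^+ u j), 0.
  rewrite mulr0 addr0 mulrA -exprD subnKC // -eu subrr; exact: spanned0.
have [bj|bj] := leqP b (u j).
  exists 0, (var i ^+ u i * var j ^+ (u j - b)).
  rewrite mulr0 add0r mulrCA -exprD subnKC // -eu subrr; exact: spanned0.
exists 0, 0; rewrite !mulr0 addr0 subr0 eu.
have : (var i ^+ u i * var j ^+ u j : polS k) \in (t : seq (polS k)).
  by apply: allpairs_f; rewrite mem_iota.
elim: t {tv} => // x t IHt; rewrite inE => /predU1P[->|/IHt xt]; apply/spanned_cons.
  exists 1, 0; split; first exact: spanned0.
  by rewrite mpolyC1 scale1r addr0.
exists 0, (var i ^+ u i * var j ^+ u j); split => //.
by rewrite mpolyC0 scale0r add0r.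
Qed.
End Monomials.

(** * Uniserial torsion sheaves at the two exceptional points *)

Section Torsion.
Variables (k : closedFieldType) (p q : nat).
Implicit Types (i : 'I_2) (y w : L p q) (X : grmod k p q) (a b : int).
Local Notation var i := (mpolyX k (mnm1 i)).
Local Notation deg i := (mdegL p q (mnm1 i)).
Local Notation other := (tperm (0 : 'I_2) 1).

(* The uniserial sheaf of length j supported at the zero of var i whose top is
   the cokernel of var i : O(y - deg i) -> O(y). *)
Definition is_torsion i y j X := mul_coker (var i ^+ j) (y - deg i *+ j) y X.

Lemma ord2P i : i = 0 \/ i = 1.
Proof. by case: i => [[|[|//]] lti]; [left | right]; apply: val_inj. Qed.

Lemma other_neq i : other i != i.
Proof. by have [->|->] := ord2P i; rewrite ?tpermL ?tpermR. Qed.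

(** Multiplication by a power of the other variable forms a pushout square with multiplication by
    [var i ^+ j], so it moves [y] without changing the cokernel. *)
Lemma is_torsion_shift_nat i y j n X :
  is_torsion i y j X <-> is_torsion i (y + deg (other i) *+ n) j X.
Proof.
apply: (@mul_coker_pushout k p q _ _ _ _ _ (var (other i) ^+ n)).
- by rewrite opprB addrC subrK; apply: homog_var.
- by rewrite opprB addrC subrK; apply: homog_var.
- by rewrite addrAC subrr add0r; apply: homog_var.
- by rewrite opprB addrA subrK addrAC subrr add0r; apply: homog_var.
- by move=> m l; apply/var_regular/other_neq.
- exact/var_cofinite/other_neq.
Qed.

Lemma is_torsion_shift i y j a X :
  is_torsion i y j X <-> is_torsion i (y + deg (other i) *~ a) j X.
Proof.
case: a => n; first exact: is_torsion_shift_nat.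
by rewrite NegzE mulrNz [X in _ <-> X](is_torsion_shift_nat _ _ _ n.+1) subrK.
Qed.

Lemma is_torsion_unique i y j X X' :
  is_torsion i y j X -> is_torsion i y j X' -> iso X X'.
Proof. exact: mul_coker_unique. Qed.

Lemma is_torsion_gshift (F : autoequiv k p q) w i y j X :
  nat_iso F (gshift k w) -> is_torsion i y j X -> is_torsion i (w + y) j (F X).
Proof. by move=> Fw /(gshift_mul_coker Fw); rewrite addrA. Qed.

Lemma Lmk0 : Lmk p q 0 0 = 0.
Proof. by apply: (addrI (Lmk p q 0 0)); rewrite -LmkD !addr0. Qed.

Lemma LmkN a b : Lmk p q (- a) (- b) = - Lmk p q a b.
Proof. by apply/eqP; rewrite -addr_eq0 -LmkD !addNr Lmk0. Qed.

Lemma LmkE a b : Lmk p q a b = x1 p q *~ a + x2 p q *~ b.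
Proof.
have LmkMz c d (n : int) : Lmk p q c d *~ n = Lmk p q (c *~ n) (d *~ n).
  case: n => n; rewrite ?NegzE ?mulrNz ?LmkN -!pmulrn LmkMn //.
by rewrite /x1 /x2 !LmkMz -LmkD !intz !mul0rz add0r addr0.
Qed.

Lemma swap_deg (e : p = q) i : swapL (deg i) = deg (other i).
Proof.
by have [->|->] := ord2P i; rewrite ?tpermL ?tpermR mdegL_x1 mdegL_x2 swapLE.
Qed.

Lemma swap_degMn (e : p = q) i n : swapL (deg i *+ n) = deg (other i) *+ n.
Proof.
elim: n => [|n IHn]; last by rewrite !mulrS swapLD // IHn swap_deg.
by apply: (addrI (swapL 0)); rewrite -swapLD // !mulr0n !addr0.
Qed.

Lemma is_torsion_sigma12 (F : autoequiv k p q) (e : p = q) w i y j X :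
  nat_iso F (fcomp (gshift k w) (sigma12 k e)) -> is_torsion i y j X ->
  is_torsion (other i) (w + swapL y) j (F X).
Proof.
move=> Fw /(sigma12_mul_coker Fw).
have -> : w + swapL (y - deg i *+ j) = w + swapL y - deg (other i) *+ j.
  rewrite -addrA; congr (_ + _); apply: (addIr (deg (other i) *+ j)).
  by rewrite -(swap_degMn e) -swapLD // !subrK.
have -> // : msym other (var i ^+ j) = var (other i) ^+ j :> polS k.
rewrite rmorphXn /= msymX; congr (mpolyX _ _ ^+ j); apply/mnmP => v.
by rewrite !mnmE tpermV (can2_eq (tpermK _ _) (tpermK _ _)).
Qed.

Lemma OO_sigma12 (F : autoequiv k p q) (e : p = q) w y X :
  nat_iso F (fcomp (gshift k w) (sigma12 k e)) -> iso X (OO k y) ->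
  iso (F X) (OO k (w + swapL y)).
Proof.
move=> Fw /(iso_fobj F)/iso_trans; apply.
apply: iso_trans (nat_iso_fobj _ Fw) _; apply: iso_trans (gshift_OO _ _ _).
by apply: (iso_fobj (gshift k w)); exists (swap_OO k e y); apply: swap_OO_iso.
Qed.

Lemma OO_gshift (F : autoequiv k p q) w y X :
  nat_iso F (gshift k w) -> iso X (OO k y) -> iso (F X) (OO k (w + y)).
Proof.
move=> Fw /(iso_fobj F)/iso_trans; apply.
by apply: iso_trans (nat_iso_fobj _ Fw) _; apply: gshift_OO.
Qed.

(** The coordinate [b] is free. This freedom later absorbs the x_2 part of a shift and the relation
    of L(p,q). *)
Lemma is_SinfE a j X b : is_Sinf a j X <-> is_torsion 0 (Lmk p q a b) j X.
Proof.
rewrite Sinf_mul_coker LmkE -(mdegL_x2 p q).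
have <- : other 0 = 1 by rewrite tpermL.
by rewrite -is_torsion_shift /is_torsion mdegL_x1 mulrzBr.
Qed.

Lemma is_S0E a j X b : is_S0 a j X <-> is_torsion 1 (Lmk p q b a) j X.
Proof.
rewrite S0_mul_coker LmkE [_ *~ b + _]addrC -(mdegL_x1 p q).
have <- : other 1 = 0 by rewrite tpermR.
by rewrite -is_torsion_shift /is_torsion mdegL_x2 mulrzBr.
Qed.

End Torsion.

(** * Lifting curves and homotopies to the strip *)

Section Continuity.
Variable R : realType.

Lemma within_comp {T U V : topologicalType} (A : set T) (B : set U)
    (f : T -> U) (g : U -> V) :
  {within A, continuous f} -> (forall x, A x -> B (f x)) -> {within B, continuous g} ->
  {within A, continuous (g \o f)}.
Proof.
move=> /subspace_continuousP cf fB /subspace_continuousP cg.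
apply/subspace_continuousP => x Ax W gW.
have h : nbhs (f x) (fun y => B y -> W (g y)) := cg _ (fB x Ax) _ gW.
have h2 : nbhs x (fun y => A y -> B (f y) -> W (g (f y))) := cf x Ax _ h.
by apply: (filterS _ h2) => y hy Ay; apply: hy => //; apply: fB.
Qed.

Lemma continuous_within_comp {T U V : topologicalType} (B : set U) (f : T -> U) (g : U -> V) :
  continuous f -> (forall x, B (f x)) -> {within B, continuous g} ->
  continuous (g \o f).
Proof.
move=> cf fB cg; apply/continuous_subspace_setT.
have cf' : {within setT, continuous f} by apply: continuous_subspaceT.
exact: (within_comp cf' (fun x _ => fB x) cg).
Qed.

Section Ops.
Variables (T : topologicalType) (f g : T -> R).
Hypotheses (cf : continuous f) (cg : continuous g).

Lemma cts_add : continuous (fun x => f x + g x).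
Proof. by move=> x; apply: cvgD; [exact: cf | exact: cg]. Qed.

Lemma cts_mul : continuous (fun x => f x * g x).
Proof. by move=> x; apply: cvgM; [exact: cf | exact: cg]. Qed.

Lemma cts_opp : continuous (fun x => - f x).
Proof. by move=> x; apply: cvgN; exact: cf. Qed.

Lemma cts_inv : (forall x, f x != 0) -> continuous (fun x => (f x)^-1).
Proof. by move=> f0 x; apply: cvgV => //; exact: cf. Qed.
End Ops.

Lemma cts_pair (T U V : topologicalType) (f : T -> U) (g : T -> V) :
  continuous f -> continuous g -> continuous (fun x => (f x, g x)).
Proof. by move=> cf cg x; apply: cvg_pair; [exact: cf | exact: cg]. Qed.

Lemma cts_fst (T U V : topologicalType) (f : T -> U * V) :
  continuous f -> continuous (fun x => (f x).1).
Proof. by move=> cf x; apply: (cvg_comp _ _ (cf x)); apply: cvg_fst. Qed.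

Lemma cts_snd (T U V : topologicalType) (f : T -> U * V) :
  continuous f -> continuous (fun x => (f x).2).
Proof. by move=> cf x; apply: (cvg_comp _ _ (cf x)); apply: cvg_snd. Qed.

Lemma cts_comp (T U V : topologicalType) (f : T -> U) (g : U -> V) :
  continuous f -> continuous g -> continuous (fun x => g (f x)).
Proof. by move=> cf cg x; apply: continuous_comp; [exact: cf | exact: cg]. Qed.

Lemma cts_cst (T U : topologicalType) (c : U) : continuous (fun _ : T => c).
Proof. by move=> x; apply: cvg_cst. Qed.

Lemma cts_id (T : topologicalType) : continuous (fun x : T => x).
Proof. by move=> x; apply: cvg_id. Qed.

(** Precomposing with this retraction of the line onto [0,1] turns curves and homotopies continuous
    within the unit interval into globally continuous ones. *)
Definition clamp (t : R) : R := Num.max 0 (Num.min 1 t).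

Lemma clamp_itv t : 0 <= clamp t <= 1.
Proof. by rewrite /clamp le_max lexx /= ge_max ler01 ge_min lexx. Qed.

Lemma clamp_id t : 0 <= t <= 1 -> clamp t = t.
Proof. by move=> /andP[t0 t1]; rewrite /clamp (min_idPr t1) (max_idPr t0). Qed.

Lemma clamp0 : clamp 0 = 0. Proof. by rewrite clamp_id // lexx ler01. Qed.
Lemma clamp1 : clamp 1 = 1. Proof. by rewrite clamp_id // lexx ler01. Qed.

Lemma continuous_clamp : continuous clamp.
Proof.
move=> t; apply: (@continuous_max R R (fun=> 0) (fun t => Num.min 1 t)).
  exact: cvg_cst.
by apply: (@continuous_min R R (fun=> 1) id); [exact: cvg_cst | exact: cvg_id].
Qed.

Lemma within_clamp (T : topologicalType) (f : R -> T) :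
  {within `[0, 1], continuous f} -> continuous (f \o clamp).
Proof.
apply: continuous_within_comp; first exact: continuous_clamp.
by move=> t /=; rewrite in_itv /= clamp_itv.
Qed.

End Continuity.

(** * Angles and the covering of the annulus by the strip *)

Section Angle.
Variable R : realType.
Implicit Types x y : R.

Lemma sin_atan x : sin (atan x) = x * cos (atan x).
Proof.
rewrite -{2}[x]atanK /tan mulfVK //.
by apply/lt0r_neq0/cos_gt0_pihalf; rewrite atan_gtNpi2 atan_ltpi2.
Qed.

(** On the right half of the unit circle the arctangent of the slope is the angle; this supplies the
    increments when an angle is followed along a homotopy. *)
Lemma cos_sin_atan x y : 0 < x -> x ^+ 2 + y ^+ 2 = 1 ->
  cos (atan (y / x)) = x /\ sin (atan (y / x)) = y.
Proof.
move=> x0 xy; have x1 : x != 0 by rewrite gt_eqF.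
have e : cos (atan (y / x)) = x.
  rewrite cos_atan (_ : 1 + _ = (x^-1) ^+ 2); last first.
    by rewrite expr_div_n -(divff (expf_neq0 2 x1)) -mulrDl xy exprVn mul1r.
  by rewrite sqrtr_sqr ger0_norm ?invrK // invr_ge0 ltW.
by rewrite sin_atan e divfK.
Qed.

Lemma cos_periodZ x (n : int) : cos (x + 2 * pi * n%:~R) = cos x.
Proof.
have h (m : nat) y : cos (y + 2 * pi * m%:R) = cos y.
  have <- : y + pi *+ 2 *+ m = y + 2 * pi * m%:R.
    by rewrite -[pi *+ 2 *+ m]mulr_natr -[pi *+ 2]mulr_natl.
  exact: periodicn (@cosD2pi R) m y.
case: n => m; first exact: h.
by rewrite NegzE mulrNz -(h m.+1) mulrN subrK.
Qed.

Lemma sin_periodZ x (n : int) : sin (x + 2 * pi * n%:~R) = sin x.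
Proof. by rewrite -!cosBpihalf addrAC cos_periodZ. Qed.

Lemma cos_eq1 x : cos (2 * pi * x) = 1 -> exists n : int, x = n%:~R.
Proof.
have p0 : 0 < 2 * pi :> R by rewrite mulr_gt0 ?pi_gt0.
have small y : 0 <= y <= 1 / 2 -> cos (2 * pi * y) = 1 -> y = 0.
  move=> /andP[y0 y1] cy; apply: (mulfI (lt0r_neq0 p0)).
  rewrite mulr0; apply: (@cos_inj R); rewrite ?cos0 // in_itv /= ?lexx ?pi_ge0 //.
  by have := pi_ge0 R; rewrite mulr_ge0 ?(ltW p0) //=; nra.
move=> cx; exists (Num.floor x).
pose y := x - (Num.floor x)%:~R; suff: y = 0 by move/eqP; rewrite subr_eq0 => /eqP.
have /andP[fx xf] := floor_itv x; rewrite intrD in xf.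
have y0 : 0 <= y by rewrite subr_ge0.
have y1 : y < 1 by rewrite ltrBlDl.
have cy : cos (2 * pi * y) = 1.
  by rewrite -[LHS](cos_periodZ _ (Num.floor x)) -mulrDr subrK.
have [yh|yh] := leP y (1 / 2); first by apply: small cy; rewrite y0.
(* When y > 1/2, the number 1 - y lies in [0, 1/2] and has the same cosine, so it would be 0,
   against y < 1. *)
suff: 1 - y = 0 by lra.
apply: small; first by apply/andP; split; lra.
by rewrite -cosN -(cos_periodZ _ 1) mulr1z -[RHS]cy; congr cos; ring.
Qed.

End Angle.

Section Cover.
Variables (R : realType).
Implicit Types P Q z w : R * R.

Lemma cover_shift z (n : int) : cover (z.1 + n%:~R, z.2) = cover z.
Proof. by rewrite /cover /= mulrDr cos_periodZ sin_periodZ. Qed.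

Lemma cover_eq z w : cover z = cover w -> exists n : int, w = (z.1 + n%:~R, z.2).
Proof.
move=> [c s y]; have /cos_eq1[n e] : cos (2 * pi * (w.1 - z.1)) = 1.
  by rewrite mulrBr cosB c s -!expr2 cos2Dsin2.
by exists n; rewrite -e addrC subrK y -surjective_pairing.
Qed.

Lemma cover_annulus z : strip z -> annulus (cover z).
Proof. by move=> h; split=> //=; apply: cos2Dsin2. Qed.

Lemma continuous_cover : continuous (@cover R).
Proof.
have cx : continuous (fun z : R * R => 2 * pi * z.1).
  by apply: cts_mul; [exact: cts_cst | apply/cts_fst/cts_id].
do 2?apply: cts_pair; last by apply/cts_snd/cts_id.
  by apply: cts_comp cx _; apply: continuous_cos.
by apply: cts_comp cx _; apply: continuous_sin.
Qed.

(** The lift is continuous and stays in the strip for every real parameter, so it composes with maps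
    of the strip directly; it is compared with [g] on [0,1] only. It may touch the boundary. *)
Definition path_lift (g : R -> R * R * R) P Q (d : R -> R * R) : Prop :=
  [/\ continuous d, d 0 = P, d 1 = Q, forall t, strip (d t) &
      forall t, 0 <= t <= 1 -> cover (d t) = g t].

Lemma path_lift_rev g P Q d :
  path_lift g P Q d -> path_lift (fun t => g (1 - t)) Q P (fun t => d (1 - t)).
Proof.
move=> [cd d0 d1 ds dg]; split=> [|||t|t /andP[t0 t1]]; rewrite ?subr0 ?subrr //.
  apply: cts_comp cd; apply: cts_add; first exact: cts_cst.
  by apply: cts_opp; apply: cts_id.
by apply: dg; apply/andP; split; lra.
Qed.

Lemma path_lift_map f F g P Q d : is_lift f F ->
  path_lift g P Q d -> path_lift (f \o g) (F P) (F Q) (F \o d).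
Proof.
move=> [cF Ff] [cd d0 d1 ds dg]; split=> [|||t|t t01] /=; rewrite ?d0 ?d1 //.
- exact: continuous_within_comp cF.
- by have [] := Ff _ (ds t).
- by have [_ ->] := Ff _ (ds t); rewrite dg.
Qed.

(** By the intermediate value theorem, distinct end values would force [h] through a
    half-integer. *)
Lemma int_path_const (h : R -> R) (m n : int) : continuous h ->
  (forall t, 0 <= t <= 1 -> exists l : int, h t = l%:~R) ->
  h 0 = m%:~R -> h 1 = n%:~R -> m = n.
Proof.
move=> ch hZ h0 h1.
have no_half (l : int) t : 0 <= t <= 1 -> h t != l%:~R + 1 / 2.
  move=> /hZ[l' ->]; apply/eqP => e.
  have : l%:~R < l'%:~R :> R by lra.
  have : l'%:~R < (l + 1)%:~R :> R by rewrite intrD; lra.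
  by rewrite !ltr_int ltzD1 leNgt => /negbTE ->.
case: (ltgtP m n) => // mn; exfalso.
- have [|t] := @IVT R h 0 1 (m%:~R + 1 / 2) ler01 (continuous_subspaceT ch).
    have : (m + 1)%:~R <= n%:~R :> R by rewrite ler_int lezD1.
    by rewrite intrD h0 h1 => H; rewrite ge_min le_max; apply/andP; split; apply/orP; lra.
  by rewrite in_itv /= => /(no_half m) /eqP.
- have [|t] := @IVT R h 0 1 (n%:~R + 1 / 2) ler01 (continuous_subspaceT ch).
    have : (n + 1)%:~R <= m%:~R :> R by rewrite ler_int lezD1.
    by rewrite intrD h0 h1 => H; rewrite ge_min le_max; apply/andP; split; apply/orP; lra.
  by rewrite in_itv /= => /(no_half n) /eqP.
Qed.

(** The horizontal difference of two lifts of one curve is continuous and integer valued, hence the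
    same at both ends. *)
Lemma path_lift_unique g P Q d P' Q' d' :
  path_lift g P Q d -> path_lift g P' Q' d' ->
  exists n : int, P' = (P.1 + n%:~R, P.2) /\ Q' = (Q.1 + n%:~R, Q.2).
Proof.
move=> [cd d0 d1 _ dg] [cd' d0' d1' _ dg'].
have key t : 0 <= t <= 1 -> exists n : int, d' t = ((d t).1 + n%:~R, (d t).2).
  by move=> t01; apply: cover_eq; rewrite dg ?dg' //. 
have [|m em] := key 0; first by rewrite lexx ler01.
have [|n en] := key 1; first by rewrite lexx ler01.
pose h t := (d' t).1 - (d t).1.
have ch : continuous h by apply: cts_add; [|apply: cts_opp]; apply: cts_fst.
have h0 : h 0 = m%:~R by rewrite /h em /= addrC addKr.
have h1 : h 1 = n%:~R by rewrite /h en /= addrC addKr.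
suff emn : m = n by exists m; rewrite -{1}d0' -{1}d1' em en d0 d1 emn.
have hZ t : 0 <= t <= 1 -> exists l : int, h t = l%:~R.
  by move=> /key[l e]; exists l; rewrite /h e /= addrC addKr.
exact: (int_path_const ch hZ h0 h1).
Qed.

End Cover.

(** * Lifting a homotopy with fixed endpoints *)

Section HomotopyLifting.
Variables (R : realType).
Implicit Types P Q z w : R * R.

(** A lift of the circle curve [(a, b)], with angles counted in full turns and prescribed end
    values. *)
Definition angle_lift (x y : R) (a b e : R -> R) : Prop :=
  [/\ continuous e, e 0 = x, e 1 = y &
      forall t, cos (2 * pi * e t) = a t /\ sin (2 * pi * e t) = b t].

(** When the unit vectors of two curves always have positive scalar product, the angle between them
    is a continuous arctangent. Added to a lift of the first curve it lifts the second, and it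
    vanishes at the ends, where the curves agree. *)
Lemma angle_lift_step x y (a b a' b' e : R -> R) :
  continuous a -> continuous b -> continuous a' -> continuous b' ->
  (forall t, a' t ^+ 2 + b' t ^+ 2 = 1) ->
  a' 0 = a 0 -> b' 0 = b 0 -> a' 1 = a 1 -> b' 1 = b 1 ->
  (forall t, 0 < a t * a' t + b t * b' t) ->
  angle_lift x y a b e -> exists e', angle_lift x y a' b' e'.
Proof.
move=> ca cb ca' cb' ab' a0 b0 a1 b1 dot [ce e0 e1 eab].
(* These are the cosine and the sine of the angle from the first vector to the second. *)
pose u t := a t * a' t + b t * b' t; pose v t := a t * b' t - b t * a' t.
have ab t : a t ^+ 2 + b t ^+ 2 = 1.
  by have [<- <-] := eab t; apply: cos2Dsin2.
have uv t : u t ^+ 2 + v t ^+ 2 = 1.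
  have <- : (a t ^+ 2 + b t ^+ 2) * (a' t ^+ 2 + b' t ^+ 2) = 1.
    by rewrite ab ab' mulr1.
  by rewrite /u /v; ring.
have p0 : 2 * pi != 0 :> R by rewrite mulf_neq0 ?lt0r_neq0 // pi_gt0.
exists (fun t => e t + (2 * pi)^-1 * atan (v t / u t)); split.
- apply: cts_add => //; apply: cts_mul; first exact: cts_cst.
  apply: (@cts_comp _ _ _ (fun t => v t / u t)); last by move=> z; apply: continuous_atan.
  apply: cts_mul; first by apply: cts_add; [|apply: cts_opp]; apply: cts_mul.
  apply: cts_inv => [|t]; last exact: (lt0r_neq0 (dot t)).
  by apply: cts_add; apply: cts_mul.
- by rewrite e0 /v a0 b0 [b 0 * _]mulrC subrr mul0r atan0 mulr0 addr0.
- by rewrite e1 /v a1 b1 [b 1 * _]mulrC subrr mul0r atan0 mulr0 addr0.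
move=> t; rewrite mulrDr mulrA divff // mul1r cosD sinD.
have [-> ->] := eab t; have [-> ->] := cos_sin_atan (dot t) (uv t).
by rewrite /u /v; split; rewrite -[RHS]mul1r -(ab t); ring.
Qed.

(** The parameters [s] whose curve lifts with the prescribed ends form a nonempty open and closed
    subset of the line, hence contain 1. *)
Lemma homotopy_lift P Q (d0 : R -> R * R) (g : R -> R * R * R) (H : R * R -> R * R * R) :
  {within `[0, 1], continuous d0} -> d0 0 = P -> d0 1 = Q ->
  {within `[0, 1] `*` `[0, 1], continuous H} ->
  (forall s t, 0 <= s <= 1 -> 0 <= t <= 1 -> annulus (H (s, t))) ->
  (forall t, 0 <= t <= 1 -> H (0, t) = cover (d0 t) /\ H (1, t) = g t) ->
  (forall s, 0 <= s <= 1 -> H (s, 0) = cover P /\ H (s, 1) = cover Q) ->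
  exists d, path_lift g P Q d.
Proof.
move=> cd d00 d01 cH annH H01 HPQ.
pose K (z : R * R) := H (clamp z.1, clamp z.2).
have cK : continuous K.
  have cc : continuous (fun z : R * R => (clamp z.1, clamp z.2)).
    apply: cts_pair; apply: cts_comp (@continuous_clamp R).
      by apply/cts_fst/cts_id.
    by apply/cts_snd/cts_id.
  apply: (continuous_within_comp cc _ cH).
  by move=> z; split; rewrite /= in_itv /= clamp_itv.
pose a s t := (K (s, t)).1.1; pose b s t := (K (s, t)).1.2.
have cKt s : continuous (fun t => K (s, t)).
  by apply: cts_comp cK; apply: cts_pair; [exact: cts_cst | exact: cts_id].
have ca s : continuous (a s) by do 2!apply: cts_fst; apply: cKt.
have cb s : continuous (b s) by apply/cts_snd/cts_fst/cKt.
have ab s t : a s t ^+ 2 + b s t ^+ 2 = 1.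
  by have [h _] := annH _ _ (clamp_itv s) (clamp_itv t); exact: h.
have K0 s : K (s, 0) = cover P by rewrite /K /= clamp0; have [] := HPQ _ (clamp_itv s).
have K1 s : K (s, 1) = cover Q by rewrite /K /= clamp1; have [] := HPQ _ (clamp_itv s).
pose A := [set s | exists e, angle_lift P.1 Q.1 (a s) (b s) e].
have A0 : A 0.
  exists (fun t => (d0 (clamp t)).1); split=> [|||t].
  - by apply: cts_fst; apply: (within_clamp cd).
  - by rewrite clamp0 d00.
  - by rewrite clamp1 d01.
  - by rewrite /a /b /K /= clamp0; have [-> _] := H01 _ (clamp_itv t).
(* Tube lemma: the curves at [s] and [s'] close enough are nowhere orthogonal. *)
have tube s : \forall s' \near s, forall t, 0 < a s t * a s' t + b s t * b s' t.
  have : \forall s' \near s, `[0, 1] `<=` [set t | 0 < a s t * a s' t + b s t * b s' t].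
    have nc := (iffLR (compact_near_coveringP _)) (@segment_compact R 0 1).
    apply: (nc R (nbhs s) (fun s' t => 0 < a s t * a s' t + b s t * b s' t)) => t _.
    pose D (z : R * R) := a s z.1 * a z.2 z.1 + b s z.1 * b z.2 z.1.
    have cD : continuous D.
      have cK' : continuous (fun z : R * R => K (z.2, z.1)).
        by apply: cts_comp cK; apply: cts_pair; [apply: cts_snd | apply: cts_fst]; apply: cts_id.
      have cK2 : continuous (fun z : R * R => K (s, z.1)).
        by apply: cts_comp (cKt s); apply/cts_fst/cts_id.
      apply: cts_add; apply: cts_mul.
      - by do 2!apply: cts_fst.
      - by do 2!apply: cts_fst.
      - by apply/cts_snd/cts_fst.
      - by apply/cts_snd/cts_fst.
    have D1 : 0 < D (t, s) by rewrite /D /= -!expr2 ab.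
    exact: (cvgr_gt _ (cD (t, s)) 0 D1).
  apply: filterS => s' h t.
  have /h : [set` `[0, 1]] (clamp t) by rewrite /= in_itv /= clamp_itv.
  by rewrite /a /b /K /= (clamp_id (clamp_itv t)).
have stepA s s' : (forall t, 0 < a s t * a s' t + b s t * b s' t) -> A s -> A s'.
  move=> dot [e]; apply: angle_lift_step => //.
  - by rewrite /a !K0.
  - by rewrite /b !K0.
  - by rewrite /a !K1.
  - by rewrite /b !K1.
have oA : open A.
  by rewrite openE => s As; rewrite /interior; apply: filterS (tube s) => s' /stepA; apply.
have cA : closed A.
  (* Positivity of the scalar product is symmetric in the two curves, so the tube around a point
     outside [A] also avoids [A]. *)
  rewrite -[A]setCK; apply: open_closedC; rewrite openE => s nAs; rewrite /interior.
  apply: filterS (tube s) => s' dot As'; apply: nAs; apply: stepA As' => t.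
  by rewrite mulrC [b s' t * _]mulrC.
have A1 : A 1.
  have : connected [set: R] by apply/connected_intervalP.
  move=> /(_ A) -> //; first by exists 0.
  - by exists A => //; rewrite setTI.
  - by exists A => //; rewrite setTI.
have [e [ce e0 e1 eab]] := A1.
exists (fun t => (e t, (K (1, t)).2)); split.
- by apply: cts_pair => //; apply: cts_snd.
- by rewrite e0 K0 -surjective_pairing.
- by rewrite e1 K1 -surjective_pairing.
- move=> t; rewrite /strip /K /= clamp1.
  by have [|//] := annH 1 (clamp t) _ (clamp_itv t); rewrite lexx ler01.
- move=> t t01; rewrite /cover /=; have [-> ->] := eab t; rewrite /a /b -!surjective_pairing.
  by rewrite /K /= clamp1 clamp_id //; have [_ ->] := H01 _ t01.
Qed.

End HomotopyLifting.

Section ArcClass.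
Variables (R : realType).
Implicit Types P Q z w : R * R.

Lemma convex_comb01 (s a b : R) : 0 <= s <= 1 -> 0 <= a <= 1 -> 0 <= b <= 1 ->
  0 <= (1 - s) * a + s * b <= 1.
Proof. by move=> /andP[? ?] /andP[? ?] /andP[? ?]; apply/andP; split; nra. Qed.

Lemma path_lift_curve (g : R -> R * R * R) P Q d : path_lift g P Q d -> curve g.
Proof.
move=> [cd _ _ ds dg]; split; last first.
  by move=> t t01; rewrite -dg //; apply: cover_annulus.
apply: (@subspace_eq_continuous _ _ _ (fun t => cover (d t))).
  by move=> t; rewrite inE /= in_itv /=; apply: dg.
by apply/continuous_subspaceT/cts_comp => //; apply: continuous_cover.
Qed.

(** One direction lifts the homotopy. For the other, the strip being convex, a straight-line
    homotopy joins any lift to a curve with interior in the open strip. *)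
Lemma arc_classP (g : R -> R * R * R) P Q : strip P -> strip Q ->
  arc_class P Q g <-> exists d, path_lift g P Q d.
Proof.
move=> sP sQ; split.
  move=> [_ [d0 [cd e0 e1 _ [H [cH annH H01 HPQ]]]]].
  apply: (homotopy_lift cd e0 e1 cH annH H01) => s s01.
  by have [-> ->] := HPQ s s01; rewrite /= e0 e1.
move=> [d dP]; have gc := path_lift_curve dP; have [cd d0 d1 ds dg] := dP.
(* The weight [w] pulls the height [l] of the segment towards 1/2, so [e] stays in the open strip
   between its ends even when [P] and [Q] lie on one boundary line. *)
pose l t := (1 - t) * P.2 + t * Q.2; pose w t : R := t * (1 - t).
pose e t := ((1 - t) * P.1 + t * Q.1, (1 - w t) * l t + w t / 2).
have c1 : continuous (fun t : R => 1 - t).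
  by apply: cts_add; [exact: cts_cst | apply: cts_opp; exact: cts_id].
have clin (a b : R) : continuous (fun t : R => (1 - t) * a + t * b).
  apply: cts_add; apply: cts_mul; [exact: c1 | exact: cts_cst | exact: cts_id | exact: cts_cst].
have cw : continuous w by apply: cts_mul => //; exact: cts_id.
have ce : continuous e.
  apply: cts_pair; first exact: clin.
  apply: cts_add; apply: cts_mul => //; last exact: cts_cst; last exact: clin.
  by apply: cts_add; [exact: cts_cst | apply: cts_opp].
have le01 t : 0 <= t <= 1 -> 0 <= l t <= 1 by move/convex_comb01; apply.
have e0 : e 0 = P by rewrite /e /l /w; case: (P) => x y /=; congr pair; ring.
have e1 : e 1 = Q by rewrite /e /l /w; case: (Q) => x y /=; congr pair; ring.
have ei t : 0 < t < 1 -> 0 < (e t).2 < 1.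
  move=> /andP[t0 t1]; have /andP[l0 l1] : 0 <= l t <= 1 by apply: le01; rewrite !ltW.
  have w0 : 0 < w t by rewrite mulr_gt0 // subr_gt0.
  have w1 : w t < 1 by rewrite /w; nra.
  by apply/andP; split; rewrite /e /=; nra.
have es t : 0 <= t <= 1 -> strip (e t).
  move=> t01; rewrite /strip /e /= -[_ / 2]/(_ * _); apply: convex_comb01 (le01 t t01) _.
    by move: t01 => /andP[t0 t1]; rewrite /w; apply/andP; split; nra.
  by apply/andP; split; lra.
clearbody e; split=> //; exists e; split=> //; first exact: continuous_subspaceT.
pose H (z : R * R) := cover ((1 - z.1) * (e z.2).1 + z.1 * (d z.2).1,
  (1 - z.1) * (e z.2).2 + z.1 * (d z.2).2).
exists H; split.
- apply: continuous_subspaceT; apply: cts_comp (@continuous_cover R).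
  have c2 : continuous (fun z : R * R => 1 - z.1).
    by apply: (cts_comp _ c1); apply/cts_fst/cts_id.
  have c3 : continuous (fun z : R * R => e z.2).
    by apply: cts_comp ce; apply/cts_snd/cts_id.
  have c4 : continuous (fun z : R * R => d z.2).
    by apply: cts_comp cd; apply/cts_snd/cts_id.
  have c5 : continuous (fun z : R * R => z.1) by apply/cts_fst/cts_id.
  apply: cts_pair; apply: cts_add; apply: cts_mul => //;
    by [apply: cts_fst | apply: cts_snd].
- move=> s t s01 t01; apply: cover_annulus.
  by apply: convex_comb01 s01 (es t t01) (ds t).
- move=> t t01; rewrite /H /= !subrr !subr0 !mul0r !mul1r !addr0 !add0r.
  by rewrite -!surjective_pairing dg.
- move=> s _; rewrite /H /= e0 e1 d0 d1.
  by split; congr cover; rewrite [RHS]surjective_pairing; congr pair; ring.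
Qed.

End ArcClass.

(** * Mappings and marked points *)

Section Boundary.
Variables (R : realType).

(** Write u(x + 1) = u(x) + d with d > 0. If d > 1, some y in [x, x + 1] has u(y) = u(x) + 1; then y
    - x is an integer, so y is an end of the interval, where u takes other values. *)
Lemma monotone_degree_one (u : R -> R) : continuous u ->
  {homo u : x y / x < y} ->
  (forall x y, (exists n : int, y = x + n%:~R) <-> (exists n : int, u y = u x + n%:~R)) ->
  forall x (n : int), u (x + n%:~R) = u x + n%:~R.
Proof.
move=> cu mu per.
have u1 x : u (x + 1) = u x + 1.
  have [|d ed] := (per x (x + 1)).1; first by exists 1.
  have d0 : u x < u (x + 1) by apply: mu; rewrite ltrDl ltr01.
  have {}d0 : (0 < d)%R by rewrite -(ltr_int R) -(ltrD2l (u x)) addr0 -ed.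
  have [d2|d2] := ltP 1 d; last first.
    by rewrite ed (_ : d = 1) //; apply/le_anti; rewrite d2 -gtz0_ge1.
  have d2' : 2 <= d%:~R :> R by rewrite (ler_int R 2).
  have x1 : x <= x + 1 by rewrite lerDl ler01.
  have [|y] := @IVT R u x (x + 1) (u x + 1) x1 (continuous_subspaceT cu).
    by rewrite ed ge_min le_max; apply/andP; split; apply/orP; [left|right]; lra.
  rewrite in_itv /= => /andP[xy yx] uy.
  have [|n en] := (per x y).2; first by exists 1.
  have n0 : n != 0 by apply: contra_eq_neq uy => n0; rewrite en n0 addr0; lra.
  have n1 : n != 1.
    by apply: contra_eq_neq uy => n1; rewrite en n1 ed; apply/eqP; lra.
  have n0' : 0 <= n by rewrite -(ler_int R); lra.
  have n1' : n <= 1 by rewrite -(ler_int R); lra.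
  by move: n n0 n1 n0' n1' {en} => [[|[|]]|].
have uN (m : nat) x : u (x + m%:R) = u x + m%:R.
  elim: m => [|m IHm]; first by rewrite !addr0.
  by rewrite -addn1 natrD !addrA u1 IHm.
move=> x [m|m]; first exact: uN.
by rewrite NegzE mulrNz; apply: (addIr m.+1%:~R); rewrite -[LHS]uN !subrK.
Qed.

(** A preimage of h(a) + 1 must be a + 1, since otherwise h(a + 1) would lie strictly between two
    consecutive integers. *)
Lemma int_monotone_surj (h : int -> int) : {homo h : a b / a < b} ->
  (forall b, exists a, h a = b) -> forall a, h a = h 0 + a.
Proof.
move=> mh sh.
have le_h a b : (h a < h b) = (a < b).
  by apply/idP/idP => [|/mh //]; apply: contraTT; rewrite -!leNgt le_eqVlt
    => /predU1P[->|/mh/ltW].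
have hS a : h (a + 1) = h a + 1.
  have [c hc] := sh (h a + 1).
  have : a < c by rewrite -le_h hc ltrDl.
  rewrite -lezD1 le_eqVlt => /predU1P[-> //|]; rewrite -le_h hc ltzD1 => h1.
  by have := mh a (a + 1); rewrite ltrDl => /(_ isT); rewrite ltNge h1.
have hN (n : nat) a : h (a + n%:Z) = h a + n%:Z.
  by elim: n => [|n IHn]; rewrite ?addr0 // -addn1 PoszD !addrA hS IHn.
case=> n; first by rewrite -[X in h X]add0r hN.
by rewrite NegzE; apply: (addIr n.+1%:Z); rewrite -hN subrK addNr.
Qed.

Lemma marked_shift (u : R -> R) (r s : nat) : (0 < r)%N -> (0 < s)%N ->
  (forall x (n : int), u (x + n%:~R) = u x + n%:~R) ->
  {homo u : x y / x < y} ->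
  (forall a : int, exists b : int, u (a%:~R / r%:R) = b%:~R / s%:R) ->
  (forall b : int, exists a k : int, u (a%:~R / r%:R) = b%:~R / s%:R + k%:~R) ->
  r = s /\ exists m : int, forall a : int, u (a%:~R / r%:R) = (a + m)%:~R / s%:R.
Proof.
move=> r0 s0 uD mu um us.
have r0' : 0 < r%:R :> R by rewrite ltr0n.
have s0' : 0 < s%:R :> R by rewrite ltr0n.
have /choice[h hE] := um.
have ratD (c t : nat) (a k : int) : (0 < t)%N ->
    (a + t%:Z * k)%:~R / t%:R = a%:~R / t%:R + k%:~R :> R.
  by move=> t0; rewrite intrD intrM mulrDl [_ * k%:~R]mulrC mulfK // pnatr_eq0 -lt0n.
have sI (a b : int) : a%:~R / s%:R = b%:~R / s%:R :> R -> a = b.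
  by move/(mulIf (lt0r_neq0 _))/intr_inj; apply; rewrite invr_gt0.
have hD a k : h (a + r%:Z * k) = h a + s%:Z * k.
  by apply: sI; rewrite -hE !ratD // uD hE.
have mh : {homo h : a b / a < b}.
  move=> a b ab; rewrite -(ltr_int R) -(ltr_pM2r (x := s%:R^-1)) ?invr_gt0 //.
  by rewrite -!hE; apply: mu; rewrite ltr_pM2r ?invr_gt0 // ltr_int.
have sh b : exists a, h a = b.
  have [a [k e]] := us b; exists (a + r%:Z * - k); rewrite hD.
  by apply: (addIr (s%:Z * k)); rewrite mulrN subrK; apply: sI; rewrite -hE e ratD.
have hE' := int_monotone_surj mh sh; split; last first.
  by exists (h 0) => a; rewrite hE hE' addrC.
(* The value of [h] at r is h(0) + s by periodicity and h(0) + r by translation. *)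
have := hD 0 1; rewrite !mulr1 add0r hE' => /addrI; by case.
Qed.

End Boundary.

Section Action.
Variables (R : realType) (p q : nat).
Hypotheses (p0 : (0 < p)%N) (q0 : (0 < q)%N).
Implicit Types (f : mapping R p q) (F : R * R -> R * R).

Lemma inner_shift a n : inner R p (a + p%:Z * n) = ((inner R p a).1 + n%:~R, 1).
Proof.
rewrite /inner /= intrD intrM mulrDl [_ * n%:~R]mulrC mulfK //.
by rewrite pnatr_eq0 -lt0n.
Qed.

Lemma outer_shift a n : outer R q (a + q%:Z * n) = ((outer R q a).1 + n%:~R, 0).
Proof.
rewrite /outer /= intrD intrM mulrDl [_ * n%:~R]mulrC mulfK //.
by rewrite pnatr_eq0 -lt0n.
Qed.

Lemma inner_inj : injective (inner R p).
Proof.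
move=> a b [] /(mulIf _)/intr_inj; apply.
by rewrite invr_neq0 // pnatr_eq0 -lt0n.
Qed.

Lemma outer_inj : injective (outer R q).
Proof.
move=> a b [] /(mulIf _)/intr_inj; apply.
by rewrite invr_neq0 // pnatr_eq0 -lt0n.
Qed.

Lemma marked_inner x : marked p q (cover (x, 1 : R)) <-> exists a, (x, 1) = inner R p a.
Proof.
split=> [[[a /esym/cover_eq[n ->]]|[b [_ _ /eqP]]]|[a ->]].
- by exists (a + p%:Z * n); rewrite inner_shift.
- by rewrite oner_eq0.
by left; exists a.
Qed.

Lemma marked_outer x : marked p q (cover (x, 0 : R)) <-> exists a, (x, 0) = outer R q a.
Proof.
split=> [[[a [_ _ /eqP]]|[b /esym/cover_eq[n ->]]]|[a ->]].
- by rewrite eq_sym oner_eq0.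
- by exists (b + q%:Z * n); rewrite outer_shift.
by right; exists a.
Qed.

Lemma lift_cover_eq f F z w : is_lift f F -> strip z -> strip w ->
  cover (F z) = cover (F w) <-> cover z = cover w.
Proof.
move=> [_ lF] sz sw; have [_ ->] := lF z sz; have [_ ->] := lF w sw.
have [g [_ _ _ gK]] := mg_homeo f.
split=> [e|->//]; have [<- _] := gK _ (cover_annulus sz).
by rewrite e; have [-> _] := gK _ (cover_annulus sw).
Qed.

Section Side.
Variables (f : mapping R p q) (F : R * R -> R * R) (y y' : R) (r s : nat).
Hypotheses (lF : is_lift f F) (r0 : (0 < r)%N) (s0 : (0 < s)%N) (y01 : 0 <= y <= 1).
Hypothesis Fy : forall x, (F (x, y)).2 = y'.
Hypothesis markr : forall x, marked p q (cover (x, y)) <->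
  exists a : int, x = a%:~R / r%:R.
Hypothesis marks : forall x, marked p q (cover (x, y')) <->
  exists a : int, x = a%:~R / s%:R.
Hypothesis fy : forall w, marked p q w -> (f w).2 = y' -> w.2 = y.

Let u x := (F (x, y)).1.

Let FE x : F (x, y) = (u x, y'). Proof. by rewrite [LHS]surjective_pairing Fy. Qed.

Let strip_y x : strip (x, y). Proof. exact: y01. Qed.

Lemma side_continuous : continuous u.
Proof.
apply: cts_fst; apply: continuous_within_comp (lF.1) => //.
by apply: cts_pair; [exact: cts_id | exact: cts_cst].
Qed.

Lemma side_periodic x x' :
  (exists n : int, x' = x + n%:~R) <-> (exists n : int, u x' = u x + n%:~R).
Proof.
have cov (c a b : R) : (exists n : int, b = a + n%:~R) <-> cover (a, c) = cover (b, c).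
  split=> [[n ->]|/cover_eq[n [->]]]; last by exists n.
  by rewrite -(cover_shift (a, c) n).
rewrite (cov y x x') (cov y' (u x) (u x')) -!FE; apply: iff_sym.
exact: lift_cover_eq lF (strip_y x) (strip_y x').
Qed.

Lemma side_marked (a : int) : exists b : int, u (a%:~R / r%:R) = b%:~R / s%:R.
Proof.
apply/marks; rewrite -FE; have [_ ->] := lF.2 _ (strip_y (a%:~R / r%:R)).
by rewrite -(mg_marked f); exists (cover (a%:~R / r%:R, y)) => //; apply/markr; exists a.
Qed.

(** The integer [k] appears because a preimage under [f] of a point of the annulus fixes a point of
    the boundary line only up to deck transformations. *)
Lemma side_marked_surj (b : int) :
  exists a k : int, u (a%:~R / r%:R) = b%:~R / s%:R + k%:~R.
Proof.
have : marked p q (cover (b%:~R / s%:R, y')) by apply/marks; exists b.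
rewrite -{1}(mg_marked f) => -[w mw fw].
have wy : w.2 = y by apply: fy => //; rewrite fw.
have [x ew] : exists x, w = cover (x, y).
  case: mw wy => -[a ->] /= <-; first by exists (inner R p a).1.
  by exists (outer R q a).1.
have [a ea] : exists a : int, x = a%:~R / r%:R by apply/markr; rewrite -ew.
exists a; have [_ e] := lF.2 _ (strip_y x); move: fw; rewrite ew -e FE ea.
by move=> /esym/cover_eq[k [->]]; exists k.
Qed.

Lemma side_increasing : {homo u : a b / a < b} ->
  r = s /\ exists m : int, forall a : int, F (a%:~R / r%:R, y) = ((a + m)%:~R / s%:R, y').
Proof.
move=> mu; have uD := monotone_degree_one side_continuous mu side_periodic.
have [rs [m mE]] := marked_shift r0 s0 uD mu side_marked side_marked_surj.
by split=> //; exists m => a; rewrite FE mE.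
Qed.

(** The arguments for increasing maps are applied to -u. *)
Lemma side_decreasing : {homo u : a b /~ a < b} ->
  r = s /\ exists m : int, forall a : int, F (a%:~R / r%:R, y) = ((m - a)%:~R / s%:R, y').
Proof.
move=> mu; pose v x := - u x.
have cv : continuous v by apply: cts_opp; apply: side_continuous.
have mv : {homo v : a b / a < b} by move=> a b ab; rewrite ltrN2; apply: mu.
have pv x x' : (exists n : int, x' = x + n%:~R) <-> (exists n : int, v x' = v x + n%:~R).
  rewrite side_periodic; split=> -[n e]; exists (- n); rewrite intrN /v ?e ?opprD //.
  by rewrite -[LHS]opprK -[- u x']/(v x') e opprD opprK.
have vD := monotone_degree_one cv mv pv.
have [||rs [m mE]] := marked_shift r0 s0 vD mv.
- move=> a; have [b e] := side_marked a; exists (- b).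
  by rewrite /v e intrN mulNr.
- move=> b; have [a [k e]] := side_marked_surj (- b); exists a, (- k).
  by rewrite /v e opprD !intrN mulNr opprK.
split=> //; exists (- m) => a.
by rewrite FE -[u _]opprK -[- u _]/(v _) mE -mulNr -intrN opprD addrC.
Qed.

End Side.

(** The generator r_2 lowers outer indices, so the sign before [n] makes [(m, n)] the coordinates of
    the shift m x_1 + n x_2. *)
Lemma mapping_action f : exists2 F, is_lift f F & exists m n : int,
  (forall a, F (inner R p a) = inner R p (a + m) /\ F (outer R q a) = outer R q (a - n)) \/
  p = q /\ forall a, F (inner R p a) = outer R q (- a - n) /\
    F (outer R q a) = inner R p (m - a).
Proof.
have [F lF orF] := mg_orientation f; exists F => //.
have mi x : marked p q (cover (x, 1 : R)) <-> exists a : int, x = a%:~R / p%:R.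
  rewrite marked_inner; split=> -[a e]; exists a; first by case: e.
  by rewrite e.
have mo x : marked p q (cover (x, 0 : R)) <-> exists a : int, x = a%:~R / q%:R.
  rewrite marked_outer; split=> -[a e]; exists a; first by case: e.
  by rewrite e.
have i0 : 0 <= (0 : R) <= 1 by rewrite lexx ler01.
have i1 : 0 <= (1 : R) <= 1 by rewrite lexx ler01.
have fF z : strip z -> (f (cover z)).2 = (F z).2.
  by move=> sz; have [_ <-] := lF.2 z sz.
have xx1 (x : R) : x < x + 1 by rewrite ltrDl ltr01.
case: orF => orF.
  have F0 x : (F (x, 0)).2 = 0 by have [] := orF x (x + 1) (xx1 x).
  have F1 x : (F (x, 1)).2 = 1 by have [] := orF x (x + 1) (xx1 x).
  have [||_ [m mE]] := side_increasing lF p0 p0 i1 F1 mi mi.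
  - move=> w [[a ->] //|[b ->]]; rewrite fF // F0 => /eqP.
    by rewrite eq_sym oner_eq0.
  - by move=> a b ab; have [] := orF a b ab.
  have [||_ [n nE]] := side_increasing lF q0 q0 i0 F0 mo mo.
  - move=> w [[b ->]|[a ->] //]; rewrite fF // F1 => /eqP.
    by rewrite oner_eq0.
  - by move=> a b ab; have [] := orF a b ab.
  by exists m, (- n); left => a; rewrite opprK /inner /outer mE nE.
have F0 x : (F (x, 0)).2 = 1 by have [] := orF x (x + 1) (xx1 x).
have F1 x : (F (x, 1)).2 = 0 by have [] := orF x (x + 1) (xx1 x).
have [||pq [n nE]] := side_decreasing lF p0 q0 i1 F1 mi mo.
- move=> w [[a ->] //|[b ->]]; rewrite fF // F0 => /eqP.
  by rewrite oner_eq0.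
- by move=> a b ab; have [] := orF b a ab.
have [||_ [m mE]] := side_decreasing lF q0 p0 i0 F0 mo mi.
- move=> w [[b ->]|[a ->] //]; rewrite fF // F1 => /eqP.
  by rewrite eq_sym oner_eq0.
- by move=> a b ab; have [] := orF b a ab.
exists m, (- n); right; split=> // a.
by rewrite /inner /outer mE nE opprK addrC.
Qed.

End Action.

(** * Rotations of the annulus and the value of psi on every mapping *)

Section Rotation.
Variables (R : realType) (p q : nat).
Hypotheses (p0 : (0 < p)%N) (q0 : (0 < q)%N).
Implicit Types (m n : int).

(** Interpolates linearly between the rotation by m/p on the inner boundary and by -n/q on the outer
    one, giving a representative of r_1^m r_2^n. *)
Definition rot_angle m n (y : R) : R := y * (m%:~R / p%:R) - (1 - y) * (n%:~R / q%:R).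

Definition rot_lift m n (z : R * R) : R * R := (z.1 + rot_angle m n z.2, z.2).

Definition rotation m n (w : R * R * R) : R * R * R :=
  let t := 2 * pi * rot_angle m n w.2 in
  (w.1.1 * cos t - w.1.2 * sin t, w.1.1 * sin t + w.1.2 * cos t, w.2).

Lemma rot_cover m n z : cover (rot_lift m n z) = rotation m n (cover z).
Proof.
by rewrite /cover /rotation /= mulrDr cosD sinD addrC; congr (_, _, _); rewrite addrC.
Qed.

Lemma rot_angleD m n m' n' y :
  rot_angle (m + m') (n + n') y = rot_angle m n y + rot_angle m' n' y.
Proof. by rewrite /rot_angle !intrD; ring. Qed.

Lemma rotD m n m' n' w : rotation (m + m') (n + n') w = rotation m n (rotation m' n' w).
Proof.
rewrite /rotation /= rot_angleD mulrDr cosD sinD.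
by congr (_, _, _); ring.
Qed.

Lemma rot0 w : rotation 0 0 w = w.
Proof.
rewrite /rotation /rot_angle !mul0r !mulr0 subrr !mulr0 cos0 sin0 !mulr0 !mulr1.
by rewrite subr0 add0r -!surjective_pairing.
Qed.

Lemma rotK m n w : rotation (- m) (- n) (rotation m n w) = w.
Proof. by rewrite -rotD !addNr rot0. Qed.

Lemma rotVK m n w : rotation m n (rotation (- m) (- n) w) = w.
Proof. by rewrite -rotD !subrr rot0. Qed.

Lemma rot_annulus m n w : annulus w -> annulus (rotation m n w).
Proof.
move=> [w1 w2]; split=> //=; rewrite -[RHS]w1.
set t := 2 * pi * _; rewrite -[RHS]mulr1 -(cos2Dsin2 t); ring.
Qed.

Lemma continuous_rot m n : continuous (rotation m n).
Proof.
have c2 : continuous (fun w : R * R * R => w.2) by apply/cts_snd/cts_id.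
have c11 : continuous (fun w : R * R * R => w.1.1) by apply/cts_fst/cts_fst/cts_id.
have c12 : continuous (fun w : R * R * R => w.1.2) by apply/cts_snd/cts_fst/cts_id.
have ct : continuous (fun w : R * R * R => 2 * pi * rot_angle m n w.2).
  apply: cts_mul; first exact: cts_cst.
  apply: cts_add; first by apply: cts_mul => //; exact: cts_cst.
  apply: cts_opp; apply: cts_mul; last exact: cts_cst.
  by apply: cts_add; [exact: cts_cst | apply: cts_opp].
have cc := cts_comp ct (@continuous_cos R); have cs := cts_comp ct (@continuous_sin R).
apply: cts_pair => //; apply: cts_pair; apply: cts_add; do ?apply: cts_opp; exact: cts_mul.
Qed.

Lemma rot_lift_inner m n a : rot_lift m n (inner R p a) = inner R p (a + m).
Proof.
rewrite /rot_lift /rot_angle /inner /= intrD; congr pair; field.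
by rewrite !pnatr_eq0 -!lt0n p0.
Qed.

Lemma rot_lift_outer m n b : rot_lift m n (outer R q b) = outer R q (b - n).
Proof.
rewrite /rot_lift /rot_angle /outer /= intrB; congr pair; field.
by rewrite !pnatr_eq0 -!lt0n ?p0 ?q0.
Qed.

Lemma rot_marked m n : rotation m n @` marked p q = marked p q.
Proof.
have sub m' n' : rotation m' n' @` marked p q `<=` marked p q.
  move=> _ [w [[a ->]|[b ->]] <-]; rewrite -rot_cover.
    by rewrite rot_lift_inner; left; exists (a + m').
  by rewrite rot_lift_outer; right; exists (b - n').
apply/seteqP; split=> // w mw; exists (rotation (- m) (- n) w); last exact: rotVK.
by apply: sub; exists w.
Qed.

Section Compose.
Variables (m n : int) (f : mapping R p q).

Lemma rot_comp_homeo : homeo (rotation m n \o f).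
Proof.
have [g [cf cg fg gK]] := mg_homeo f.
exists (g \o rotation (- m) (- n)); split.
- apply: (within_comp (B := setT) cf) => //.
  by apply: continuous_subspaceT; apply: continuous_rot.
- apply: (within_comp (B := @annulus R)) cg; last exact: rot_annulus.
  by apply: continuous_subspaceT; apply: continuous_rot.
- by move=> z az; split; [apply/rot_annulus; case: (fg z az) |
    case: (fg _ (rot_annulus (- m) (- n) az))].
- move=> z az /=; rewrite rotK; have [-> _] := gK z az; split=> //.
  by have [_ ->] := gK _ (rot_annulus (- m) (- n) az); rewrite rotVK.
Qed.

Lemma rot_comp_marked : (rotation m n \o f) @` marked p q = marked p q.
Proof. by rewrite -image_comp mg_marked rot_marked. Qed.

Lemma rot_comp_lift F : is_lift f F -> is_lift (rotation m n \o f) (rot_lift m n \o F).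
Proof.
move=> [cF FP]; split.
  apply: (within_comp (B := setT) cF) => //; apply: continuous_subspaceT.
  apply: cts_pair; last by apply/cts_snd/cts_id.
  apply: cts_add; first by apply/cts_fst/cts_id.
  apply: cts_add; first by apply: cts_mul; [apply/cts_snd/cts_id | exact: cts_cst].
  apply: cts_opp; apply: cts_mul; last exact: cts_cst.
  by apply: cts_add; [exact: cts_cst | apply: cts_opp; apply/cts_snd/cts_id].
by move=> z sz; have [sF e] := FP z sz; split; rewrite //= rot_cover e.
Qed.

Lemma rot_comp_orientation : orientation_preserving (rotation m n \o f).
Proof.
have [F lF oF] := mg_orientation f; exists (rot_lift m n \o F).
  exact: rot_comp_lift.
have xx1 (x : R) : x < x + 1 by rewrite ltrDl ltr01.
case: oF => oF; [left|right] => x y xy; have [x0 x1 F0 F1] := oF x y xy;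
  have [y0 y1 _ _] := oF y _ (xx1 y); split => //=; by rewrite ?x0 ?x1 ?y0 ?y1 ?ltrD2r.
Qed.

Definition rot_comp : mapping R p q :=
  Mapping rot_comp_homeo rot_comp_marked rot_comp_orientation.

End Compose.

Lemma id_homeo : homeo (@id (R * R * R)).
Proof.
exists id; split=> //; apply: continuous_subspaceT; exact: cts_id.
Qed.

Lemma id_lift : is_lift (@id (R * R * R)) id.
Proof. by split=> //; apply: continuous_subspaceT; exact: cts_id. Qed.

Lemma id_orientation : orientation_preserving (@id (R * R * R)).
Proof. by exists id; [exact: id_lift | left]. Qed.

Definition id_mapping : mapping R p q :=
  Mapping id_homeo (image_id _) id_orientation.

Section Psi.
Variables (k : closedFieldType) (psi : mapping R p q -> autoequiv k p q).
Hypothesis hpsi : is_psi psi.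

Let rot_mapping m n := rot_comp m n id_mapping.

Lemma psi_rot_comp m n f :
  nat_iso (psi (rot_comp m n f)) (fcomp (psi (rot_mapping m n)) (psi f)).
Proof. exact: (psi_comp hpsi). Qed.

(** Shifts are invertible, so the value of psi passes both ways across composition with [g]; this
    allows induction over all integers. *)
Lemma psi_shift_step w y (g f h : mapping R p q) :
  nat_iso (psi g) (gshift k w) -> (forall z, annulus z -> h z = g (f z)) ->
  nat_iso (psi f) (gshift k y) <-> nat_iso (psi h) (gshift k (w + y)).
Proof.
move=> gw hgf; have hc := nat_iso_trans (psi_comp hpsi hgf) (nat_iso_compr (psi f) gw).
split=> e.
  apply: nat_iso_trans hc _; apply: nat_iso_trans (nat_iso_compl _ e) _.
  exact/gshiftD/addrC.
apply: nat_iso_trans (gshift_move hc) _; apply: nat_iso_trans (nat_iso_compl _ e) _.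
by apply: gshiftD; rewrite addrC addKr.
Qed.

Lemma psi_rot m n : nat_iso (psi (rot_mapping m n)) (gshift k (Lmk p q m n)).
Proof.
have r1 : nat_iso (psi (rot_mapping 1 0)) (gshift k (x1 p q)).
  apply: (psi_r1 hpsi); exists (rot_lift 1 0 \o id).
    exact: (@rot_comp_lift 1 0 id_mapping _ id_lift).
  by move=> a; rewrite /= rot_lift_inner rot_lift_outer subr0.
have r2 : nat_iso (psi (rot_mapping 0 1)) (gshift k (x2 p q)).
  apply: (psi_r2 hpsi); exists (rot_lift 0 1 \o id).
    exact: (@rot_comp_lift 0 1 id_mapping _ id_lift).
  by move=> a; rewrite /= rot_lift_inner rot_lift_outer addr0.
have step1 a b : nat_iso (psi (rot_mapping a b)) (gshift k (Lmk p q a b)) <->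
    nat_iso (psi (rot_mapping (1 + a) b)) (gshift k (Lmk p q (1 + a) b)).
  rewrite -{4}[b]add0r LmkD; apply: psi_shift_step r1 _ => z _ /=.
  by rewrite -rotD add0r.
have step2 a b : nat_iso (psi (rot_mapping a b)) (gshift k (Lmk p q a b)) <->
    nat_iso (psi (rot_mapping a (1 + b))) (gshift k (Lmk p q a (1 + b))).
  rewrite -{4}[a]add0r LmkD; apply: psi_shift_step r2 _ => z _ /=.
  by rewrite -rotD add0r.
(* Running [step1] backwards from r_1 gives the value at the identity. *)
have base : nat_iso (psi (rot_mapping 0 0)) (gshift k (Lmk p q 0 0)).
  by apply/step1; rewrite !addr0.
have {}base a : nat_iso (psi (rot_mapping a 0)) (gshift k (Lmk p q a 0)).
  elim/int_ind: a => // a; first by move/step1; rewrite -intS.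
  by move=> h; apply/step1; rewrite intS opprD addrA subrr add0r.
elim/int_ind: n => // a; first by move/step2; rewrite -intS.
by move=> h; apply/step2; rewrite intS opprD addrA subrr add0r.
Qed.

Lemma psi_noswap (f : mapping R p q) F m n : is_lift f F ->
  (forall a, F (inner R p a) = inner R p (a + m) /\ F (outer R q a) = outer R q (a - n)) ->
  nat_iso (psi f) (gshift k (Lmk p q m n)).
Proof.
(* This rotation is chosen so that the composite moves inner indices by 1 and fixes outer ones: it
   lies in the class r_1, where psi is prescribed. *)
move=> lF Fmn; apply/(psi_shift_step _ (h := rot_comp (1 - m) (- n) f)
  (psi_rot (1 - m) (- n))) => //.
rewrite -LmkD subrK addNr; apply: (psi_r1 hpsi).
exists (rot_lift (1 - m) (- n) \o F); first exact: rot_comp_lift.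
move=> a /=; have [-> ->] := Fmn a; rewrite rot_lift_inner rot_lift_outer.
by rewrite opprK subrK -addrA [m + _]addrC subrK.
Qed.

Lemma psi_swap (e : p = q) (f : mapping R p q) F m n : is_lift f F ->
  (forall a, F (inner R p a) = outer R q (- a - n) /\ F (outer R q a) = inner R p (m - a)) ->
  nat_iso (psi f) (fcomp (gshift k (Lmk p q m n)) (sigma12 k e)).
Proof.
(* Undoing both translations leaves exactly the class sigma. *)
move=> lF Fmn; pose h := rot_comp (- m) (- n) f.
have hs : nat_iso (psi h) (sigma12 k e).
  apply: (psi_sigma hpsi); exists (rot_lift (- m) (- n) \o F).
    exact: rot_comp_lift.
  move=> a /=; have [-> ->] := Fmn a; rewrite rot_lift_inner rot_lift_outer.
  by rewrite opprK subrK addrAC subrr add0r.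
have hc := nat_iso_trans (psi_rot_comp (- m) (- n) f)
  (nat_iso_compr (psi f) (psi_rot (- m) (- n))).
apply: nat_iso_trans (gshift_move hc) _.
rewrite -LmkN !opprK; exact: nat_iso_compl.
Qed.

End Psi.

End Rotation.

(** * Arcs *)

(** Names for curves by the indices of their endpoints in the strip; a class has one name for each
    deck transformation [arc_shift]. *)
Variant arc_index := Bridge of int & int | PerInner of int & int | PerOuter of int & int.

Section Arcs.
Variables (R : realType) (p q : nat).
Hypotheses (p0 : (0 < p)%N) (q0 : (0 < q)%N).
Implicit Types (a b : arc_index) (g : R -> R * R * R).

Definition arc_src a : R * R :=
  match a with
  | Bridge i j => outer R q j | PerInner i j => inner R p i | PerOuter i j => outer R q i
  end.

Definition arc_tgt a : R * R :=
  match a with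
  | Bridge i j => inner R p i | PerInner i j => inner R p j | PerOuter i j => outer R q j
  end.

Definition arc_valid a : Prop :=
  match a with Bridge i j => True | PerInner i j | PerOuter i j => (2 <= j - i)%R end.

Definition arc_shift (n : int) a : arc_index :=
  match a with
  | Bridge i j => Bridge (i + p%:Z * n) (j + q%:Z * n)
  | PerInner i j => PerInner (i + p%:Z * n) (j + p%:Z * n)
  | PerOuter i j => PerOuter (i + q%:Z * n) (j + q%:Z * n)
  end.

Definition arc_set a : set (R -> R * R * R) := arc_class (arc_src a) (arc_tgt a).

Lemma oriented_classP c : oriented_class p q c <-> exists2 a, arc_valid a & c = arc_set a.
Proof.
split=> [[[i [j ->]]|[i [j [ij ->]]]|[i [j [ij ->]]]]|[[i j|i j|i j] ij ->]].
- by exists (Bridge i j).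
- by exists (PerInner i j).
- by exists (PerOuter i j).
- by constructor 1; exists i, j.
- by constructor 2; exists i, j.
- by constructor 3; exists i, j.
Qed.

Lemma strip_inner i : strip (inner R p i).
Proof. by rewrite /strip /= lexx ler01. Qed.

Lemma strip_outer i : strip (outer R q i).
Proof. by rewrite /strip /= lexx ler01. Qed.

Lemma strip_src a : strip (arc_src a).
Proof. by case: a => i j; [exact: strip_outer | exact: strip_inner | exact: strip_outer]. Qed.

Lemma strip_tgt a : strip (arc_tgt a).
Proof. by case: a => i j; [exact: strip_inner | exact: strip_inner | exact: strip_outer]. Qed.

Lemma arc_setP a g : arc_set a g <-> exists d, path_lift g (arc_src a) (arc_tgt a) d.
Proof. exact: arc_classP (strip_src a) (strip_tgt a). Qed.

Lemma arc_set_nonempty a : exists g, arc_set a g.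
Proof.
pose d (t : R) := ((1 - t) * (arc_src a).1 + t * (arc_tgt a).1,
  (1 - clamp t) * (arc_src a).2 + clamp t * (arc_tgt a).2).
exists (fun t => cover (d t)); apply/arc_setP; exists d; split=> //.
- have clin (x y : R) : continuous (fun t : R => (1 - t) * x + t * y).
    apply: cts_add; apply: cts_mul; [|exact: cts_cst|exact: cts_id|exact: cts_cst].
    by apply: cts_add; [exact: cts_cst | apply: cts_opp; exact: cts_id].
  apply: cts_pair; first exact: clin.
  exact: (cts_comp (@continuous_clamp R) (clin _ _)).
- by rewrite /d clamp0 !subr0 !mul1r !mul0r !addr0 -surjective_pairing.
- by rewrite /d clamp1 !subrr !mul1r !mul0r !add0r -surjective_pairing.
- by move=> t; apply: convex_comb01 (clamp_itv t) (strip_src a) (strip_tgt a).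
Qed.

Lemma arc_shift_src n a : arc_src (arc_shift n a) = ((arc_src a).1 + n%:~R, (arc_src a).2).
Proof. by case: a => i j; rewrite /= ?inner_shift ?outer_shift. Qed.

Lemma arc_shift_tgt n a : arc_tgt (arc_shift n a) = ((arc_tgt a).1 + n%:~R, (arc_tgt a).2).
Proof. by case: a => i j; rewrite /= ?inner_shift ?outer_shift. Qed.

Lemma arc_ends_inj a b : arc_valid a -> arc_valid b ->
  arc_src a = arc_src b -> arc_tgt a = arc_tgt b -> a = b.
Proof.
have io i j : inner R p i = outer R q j -> False.
  by move=> [_ /eqP]; rewrite oner_eq0.
case: a b => [i j|i j|i j] [i' j'|i' j'|i' j'] va vb /= es et;
  do ?[by case: (io _ _ es) | by case: (io _ _ (esym es))
      | by case: (io _ _ et) | by case: (io _ _ (esym et))].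
- by rewrite (inner_inj p0 et) (outer_inj q0 es).
- by rewrite (inner_inj p0 es) (inner_inj p0 et).
- by rewrite (outer_inj q0 es) (outer_inj q0 et).
Qed.

Lemma arc_shift_valid n a : arc_valid a -> arc_valid (arc_shift n a).
Proof. by case: a => i j //=; rewrite opprD addrACA subrr addr0. Qed.

Lemma arc_set_meet a b g : arc_valid a -> arc_valid b ->
  arc_set a g -> arc_set b g -> exists n, b = arc_shift n a.
Proof.
move=> va vb /arc_setP[d dP] /arc_setP[d' dP'].
have [n [es et]] := path_lift_unique dP dP'; exists n.
apply: arc_ends_inj => //; first exact: arc_shift_valid.
  by rewrite es arc_shift_src.
by rewrite et arc_shift_tgt.
Qed.

(** A reversed bridging arc runs from the inner to the outer boundary. A reversed peripheral arc has
    decreasing indices, whereas valid names have [j - i] at least 2. *)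
Lemma arc_set_rev a b g : arc_valid a -> arc_valid b ->
  arc_set a g -> arc_set b (fun t => g (1 - t)) -> False.
Proof.
move=> va vb /arc_setP[d /path_lift_rev dP] /arc_setP[d' dP'].
have [n [es et]] := path_lift_unique dP dP'.
have pr (s : nat) (i j i' j' : int) : (0 < s)%N ->
    i'%:~R / s%:R = j%:~R / s%:R + n%:~R :> R ->
    j'%:~R / s%:R = i%:~R / s%:R + n%:~R :> R -> j - i = i' - j'.
  move=> s0 e1 e2; have : (j%:~R - i%:~R) / s%:R = (i'%:~R - j'%:~R) / s%:R :> R.
    by rewrite !mulrBl e1 e2; ring.
  move/(mulIf _); rewrite -!intrB => /(_ _)/intr_inj; apply.
  by rewrite invr_neq0 // pnatr_eq0 -lt0n.
move: (congr1 fst es) (congr1 snd es) (congr1 fst et) (congr1 snd et) => {dP dP' es et}.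
case: a b va vb => [i j|i j|i j] [i' j'|i' j'|i' j'] /= va vb e1 y1 e2 y2;
  do ?[by move/eqP: y1; rewrite ?oner_eq0 // eq_sym oner_eq0
      |by move/eqP: y2; rewrite ?oner_eq0 // eq_sym oner_eq0].
- have := pr _ _ _ _ _ p0 e1 e2; lia.
- have := pr _ _ _ _ _ q0 e1 e2; lia.
Qed.

Lemma arc_set_shift n a : arc_set (arc_shift n a) = arc_set a.
Proof.
have sub m b g : arc_set b g -> arc_set (arc_shift m b) g.
  move=> /arc_setP[d [cd d0 d1 ds dg]]; apply/arc_setP.
  exists (fun t => ((d t).1 + m%:~R, (d t).2)); split.
  - apply: cts_pair; last exact: cts_snd.
    by apply: cts_add; [apply: cts_fst | exact: cts_cst].
  - by rewrite d0 arc_shift_src.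
  - by rewrite d1 arc_shift_tgt.
  - exact: ds.
  - by move=> t t01; rewrite cover_shift dg.
apply/seteqP; split=> g; last exact: sub.
move=> /(sub (- n)); congr (arc_set _ g).
by case: a => i j /=; rewrite !mulrN !addrK.
Qed.

Section Action.
Variables (f : mapping R p q) (F : R * R -> R * R) (act : arc_index -> arc_index).
Hypothesis lF : is_lift f F.

(* [act] describes the images under [f] of all oriented arcs, whose orientation
   is reversed when [swap] holds. *)
Definition arc_action (swap : bool) : Prop := forall a,
  (arc_src (act a), arc_tgt (act a)) =
    if swap then (F (arc_tgt a), F (arc_src a)) else (F (arc_src a), F (arc_tgt a)).

Variable swap : bool.
Hypothesis actP : arc_action swap.

Lemma arc_action_set a g : arc_set a g ->
  arc_set (act a) (if swap then fun t => f (g (1 - t)) else f \o g).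
Proof.
move=> /arc_setP[d /(path_lift_map lF) dP]; apply/arc_setP.
have := actP a; case: swap => -[-> ->]; last by exists (F \o d).
by exists (fun t => (F \o d) (1 - t)); apply: (path_lift_rev dP).
Qed.

Hypothesis act_valid : forall a, arc_valid a -> arc_valid (act a).

Lemma arc_action_image a b g : arc_valid a -> arc_valid b -> arc_set a g ->
  arc_set b (f \o g) \/ arc_set b (fun t => f (g (1 - t))) ->
  arc_set b = arc_set (act a).
Proof.
move=> va vb /arc_action_set h hb; have va' := act_valid va.
have same h' : arc_set (act a) h' -> arc_set b h' -> arc_set b = arc_set (act a).
  by move=> h1 h2; have [n ->] := arc_set_meet va' vb h1 h2; apply: arc_set_shift.
case: swap h hb => h [] hb.
- case: (arc_set_rev vb va' hb); exact: h.
- exact: same h hb.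
- exact: same h hb.
- case: (arc_set_rev va' vb h hb).
Qed.

End Action.
End Arcs.

(** * Triangulations and tilting sheaves *)

Section Correspondence.
Variables (R : realType) (k : closedFieldType) (p q : nat).
Hypotheses (p0 : (0 < p)%N) (q0 : (0 < q)%N).
Implicit Types (a b : arc_index) (X Y : grmod k p q).

(** The length [j - i - 1] counts the marked points strictly between the two endpoints; the
    coordinate 0 is an arbitrary choice, as the cokernel does not depend on it. *)
Definition arc_sheaf a X : Prop :=
  match a with
  | Bridge i j => iso X (OO k (Lmk p q i (- j)))
  | PerInner i j => is_torsion 0 (Lmk p q j 0) `|(j - i - 1)%R|%N X
  | PerOuter i j => is_torsion 1 (Lmk p q 0 (- i)) `|(j - i - 1)%R|%N X
  end.

Lemma is_torsion0_indep (u v w : int) l X :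
  is_torsion 0 (Lmk p q u v) l X <-> is_torsion 0 (Lmk p q u w) l X.
Proof. by rewrite -!is_SinfE. Qed.

Lemma is_torsion1_indep (u v w : int) l X :
  is_torsion 1 (Lmk p q v u) l X <-> is_torsion 1 (Lmk p q w u) l X.
Proof. by rewrite -!is_S0E. Qed.

Lemma phiP c X : phi c X <-> exists a : arc_index,
  [/\ arc_valid a, c = @arc_set R p q a & arc_sheaf a X].
Proof.
have OOE i j : x1 p q *~ i - x2 p q *~ j = Lmk p q i (- j) by rewrite LmkE mulrNz.
split.
- move=> [[i [j [-> h]]]|[i [l [l0 -> h]]]|[i [l [l0 -> h]]]].
  + by exists (Bridge i j); split=> //; rewrite /= -OOE.
  + exists (PerInner (i - l%:Z - 1) i); split=> //=; first by lia.
    by rewrite (_ : `|_|%N = l); [apply/is_SinfE | lia].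
  + exists (PerOuter (- i) (l%:Z - i + 1)); split=> //=; first by lia.
    by rewrite (_ : `|_|%N = l) ?opprK; [apply/is_S0E | lia].
- move=> [[i j|i j|i j] [/= va -> h]].
  + by constructor 1; exists i, j; rewrite OOE.
  + constructor 2; exists j, `|(j - i - 1)%R|%N; split; first by lia.
      by rewrite /arc_set /per_inner /=; congr (arc_class (inner R p _) _); lia.
    exact/is_SinfE/h.
  + constructor 3; exists (- i), `|(j - i - 1)%R|%N; split; first by lia.
      rewrite opprK /arc_set /per_outer /=; congr (arc_class _ (outer R q _)); lia.
    exact/is_S0E/h.
Qed.

Lemma Lmk_period (u v n : int) : Lmk p q (u + p%:Z * n) (v - q%:Z * n) = Lmk p q u v.
Proof. by apply/LmkP; exists n; split; ring. Qed.

(** The deck transformation changes the degree of a line bundle by n(p x_1 - q x_2) = 0, so the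
    sheaf depends on the class and not on its name. *)
Lemma arc_sheaf_shift n a X : arc_sheaf (arc_shift p q n a) X <-> arc_sheaf a X.
Proof.
case: a => i j /=.
- by rewrite opprD Lmk_period.
- rewrite (_ : `|_|%N = `|(j - i - 1)%R|%N); last by lia.
  (* The free coordinate is set to -qn to compensate the pn in the other one. *)
  by rewrite (is_torsion0_indep _ 0 (0 - q%:Z * n)) Lmk_period.
- rewrite (_ : `|_|%N = `|(j - i - 1)%R|%N); last by lia.
  rewrite (is_torsion1_indep _ 0 (0 + p%:Z * n)) opprD Lmk_period.
  by [].
Qed.

Lemma arc_sheaf_unique a X Y : arc_sheaf a X -> arc_sheaf a Y -> iso X Y.
Proof.
case: a => i j /=; do ?exact: is_torsion_unique.
by move=> h h'; apply: iso_trans h (iso_sym h').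
Qed.

Lemma phi_unique c X Y : phi (R := R) c X -> phi c Y -> iso X Y.
Proof.
move=> /phiP[a [va -> aX]] /phiP[b [vb ab bY]].
have [g ag] := @arc_set_nonempty R p q a; have bg := ag; rewrite ab in bg.
have [n eb] := arc_set_meet p0 q0 va vb ag bg; rewrite {}eb in bY.
exact: arc_sheaf_unique aX (iffLR (arc_sheaf_shift n a Y) bY).
Qed.

Definition act_noswap (m n : int) a : arc_index :=
  match a with
  | Bridge i j => Bridge (i + m) (j - n)
  | PerInner i j => PerInner (i + m) (j + m)
  | PerOuter i j => PerOuter (i - n) (j - n)
  end.

(** Exchanging the boundaries reverses every arc: the image of the target becomes the source, which
    restores the prescribed orientations. *)
Definition act_swap (m n : int) a : arc_index :=
  match a with
  | Bridge i j => Bridge (m - j) (- i - n)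
  | PerInner i j => PerOuter (- j - n) (- i - n)
  | PerOuter i j => PerInner (m - j) (m - i)
  end.

Lemma arc_sheaf_noswap (Phi : autoequiv k p q) m n a X :
  nat_iso Phi (gshift k (Lmk p q m n)) ->
  arc_sheaf a X -> arc_sheaf (act_noswap m n a) (Phi X).
Proof.
move=> hPhi; case: a => i j /= h.
- rewrite (_ : Lmk _ _ _ _ = Lmk p q m n + Lmk p q i (- j)); first exact: OO_gshift.
  by rewrite -LmkD; congr Lmk; lia.
- have := is_torsion_gshift hPhi h; rewrite -LmkD [m + j]addrC.
  rewrite (_ : `|_|%N = `|(j - i - 1)%R|%N); last by lia.
  by rewrite (is_torsion0_indep _ _ 0).
- have := is_torsion_gshift hPhi h; rewrite -LmkD.
  rewrite (_ : `|(j - n - _ - _)%R|%N = `|(j - i - 1)%R|%N); last by lia.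
  by rewrite (is_torsion1_indep _ _ 0) opprB.
Qed.

Lemma arc_sheaf_swap (e : p = q) (Phi : autoequiv k p q) m n a X :
  nat_iso Phi (fcomp (gshift k (Lmk p q m n)) (sigma12 k e)) ->
  arc_sheaf a X -> arc_sheaf (act_swap m n a) (Phi X).
Proof.
move=> hPhi; case: a => i j /= h.
- have := OO_sigma12 hPhi h; rewrite swapLE // -LmkD.
  by congr (iso _ (OO k (Lmk _ _ _ _))); lia.
- have := is_torsion_sigma12 hPhi h; rewrite tpermL swapLE // -LmkD.
  rewrite (is_torsion1_indep _ _ 0).
  rewrite (_ : `|(- i - n - _ - _)%R|%N = `|(j - i - 1)%R|%N); last by lia.
  by congr (is_torsion _ (Lmk _ _ _ _)); lia.
- have := is_torsion_sigma12 hPhi h; rewrite tpermR swapLE // -LmkD.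
  rewrite (is_torsion0_indep _ _ 0).
  rewrite (_ : `|(m - i - _ - _)%R|%N = `|(j - i - 1)%R|%N); last by lia.
  by congr (is_torsion _ (Lmk _ _ _ _)); lia.
Qed.

Section Transport.
Variables (f : mapping R p q) (Phi : autoequiv k p q).
Variables (F : R * R -> R * R) (act : arc_index -> arc_index) (swap : bool).
Hypothesis lF : is_lift f F.
Hypothesis actP : arc_action p q F act swap.
Hypothesis act_valid : forall a, arc_valid a -> arc_valid (act a).
Hypothesis act_inj : forall n a b, act a = arc_shift p q n (act b) ->
  exists n', a = arc_shift p q n' b.
Hypothesis act_sheaf : forall a X, arc_sheaf a X -> arc_sheaf (act a) (Phi X).

Let arc_set := @arc_set R p q.

(** Equal image classes have names differing by a deck transformation, which [act_inj] pulls back.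
    Conversely, the image under [f] of a common curve lies in both image classes. *)
Lemma arc_set_act a b : arc_valid a -> arc_valid b ->
  (arc_set (act a) = arc_set (act b)) <-> (arc_set a = arc_set b).
Proof.
move=> va vb; split=> ab.
  have [g ag] := @arc_set_nonempty R p q (act a); have bg := ag.
  rewrite -/(arc_set _) ab in bg.
  have [n /act_inj[n' ->]] := arc_set_meet p0 q0 (act_valid vb) (act_valid va) bg ag.
  exact: arc_set_shift.
have [g ag] := @arc_set_nonempty R p q a.
apply: (arc_action_image p0 q0 lF actP act_valid vb (act_valid va)) (_ : arc_set b g) _.
  by rewrite -ab.
have := arc_action_set lF actP ag; case: swap => h; [right | left]; exact: h.
Qed.

(* The action of [f] on the homotopy classes of the oriented arcs *)
Lemma transport_exists : exists T T' : set (R -> R * R * R) -> set (R -> R * R * R),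
  forall a, arc_valid a -> T (arc_set a) = arc_set (act a) /\ T' (arc_set (act a)) = arc_set a.
Proof.
have /choice[T TP] : forall c, exists c', forall a,
    arc_valid a -> c = arc_set a -> c' = arc_set (act a).
  move=> c; have [[a [va ->]]|no] := pselect (exists a, arc_valid a /\ c = arc_set a).
    by exists (arc_set (act a)) => b vb ab; apply/arc_set_act.
  by exists c => a va ca; case: no; exists a.
have /choice[T' TP'] : forall c, exists c', forall a,
    arc_valid a -> c = arc_set (act a) -> c' = arc_set a.
  move=> c; have [[a [va ->]]|no] := pselect (exists a, arc_valid a /\ c = arc_set (act a)).
    by exists (arc_set a) => b vb /(iffLR (arc_set_act va vb)).
  by exists c => a va ca; case: no; exists a.
by exists T, T' => a va; split; [apply: TP | apply: TP'].
Qed.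

(** The maps [T] and [T'] put the summands of both sides in bijection, and [Phi] sends each summand
    to the matching one. As [Phi] preserves direct sums, uniqueness of the sum gives one direction
    and its invariance under isomorphism the other. *)
Lemma phi_sum_transport (Gamma : set (set (R -> R * R * R))) X X' :
  phi_sum Gamma X ->
  phi_sum (image_triangulation f Gamma) X' <-> iso X' (Phi X).
Proof.
move=> [Xs [phiXs dsX]]; have [T [T' TP]] := transport_exists.
(* A class carrying a sheaf under [phi] has a valid name. *)
have validG c : Gamma c -> exists2 a, arc_valid a & c = arc_set a.
  by move=> Gc; have /phiP[a [va e _]] := phiXs (exist _ c Gc); exists a.
have imE c' : image_triangulation f Gamma c' <-> exists2 c, Gamma c & c' = T c.
  split.
    move=> [/oriented_classP[b vb ->] [c [g [Gc cg h]]]].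
    have [a va ea] := validG c Gc; exists c => //; rewrite ea in cg *.
    have [-> _] := TP a va.
    exact: (arc_action_image p0 q0 lF actP act_valid va vb cg h).
  move=> [c Gc ->]; have [a va ea] := validG c Gc; rewrite ea; have [-> _] := TP a va.
  split; first by apply/oriented_classP; exists (act a) => //; apply: act_valid.
  have [g ag] := @arc_set_nonempty R p q a; exists c, g; split=> //; first by rewrite ea.
  by have := arc_action_set lF actP ag; case: swap => h; [right | left]; exact: h.
have phiT c Y : Gamma c -> phi c Y -> phi (T c) (Phi Y).
  move=> Gc /phiP[a [va -> aY]]; have [-> _] := TP a va; apply/phiP; exists (act a).
  by split=> //; [apply: act_valid | apply: act_sheaf].
have TK c : Gamma c -> T' (T c) = c.
  by move=> /validG[a va ->]; have [e1 e2] := TP a va; rewrite e1 e2.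
pose I := {c | Gamma c}; pose J := {c | image_triangulation f Gamma c}.
have im_T (x : I) : image_triangulation f Gamma (T (proj1_sig x)).
  by apply/imE; exists (proj1_sig x) => //; apply: proj2_sig.
have G_T' (y : J) : Gamma (T' (proj1_sig y)).
  by case: y => c' /= /imE[c Gc ->]; rewrite TK.
pose b (y : J) : I := exist _ _ (G_T' y); pose c (x : I) : J := exist _ _ (im_T x).
have cK : cancel c b.
  by move=> [x Gx]; apply: eq_exist; rewrite /= TK.
have bK : cancel b c.
  move=> [y Jy]; apply: eq_exist => /=; have /imE[x Gx ->] := Jy.
  by rewrite TK.
have phib (y : J) : phi (proj1_sig y) (Phi (Xs (b y))).
  rewrite -[y in proj1_sig y]bK; exact: phiT (proj2_sig (b y)) (phiXs (b y)).
have dsPhi := autoequiv_directsum Phi dsX; split.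
  move=> [Ys [phiYs dsX']].
  have XY y : iso (Phi (Xs (b y))) (Ys y) := phi_unique (phib y) (phiYs y).
  exact: is_directsum_unique dsX' (is_directsum_reindex bK cK XY dsPhi).
move=> X'X; exists (fun y => Phi (Xs (b y))); split; first exact: phib.
apply: is_directsum_iso (iso_sym X'X) _.
by apply: (is_directsum_reindex bK cK _ dsPhi) => y; apply: iso_refl.
Qed.

End Transport.
End Correspondence.

Theorem theorem1p1 (R : realType) (k : closedFieldType) (p q : nat)
    (hp : (1 <= p)%N) (hpq : (p <= q)%N)
    (psi : mapping R p q -> autoequiv k p q) (hpsi : is_psi psi)
    (f : mapping R p q) (Gamma : set (set (R -> R * R * R)))
    (hGamma : triangulation p q Gamma)
    (X : grmod k p q) (hX : phi_sum Gamma X) (X' : grmod k p q) :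
  phi_sum (image_triangulation f Gamma) X' <-> iso X' (psi f X).
Proof.
have hq := leq_trans hp hpq.
have [F lF [m [n [Fmn|[e Fmn]]]]] := mapping_action hp hq f.
  have hpsif := psi_noswap hp hq hpsi lF Fmn.
  apply: (@phi_sum_transport R k p q hp hq f (psi f) F (act_noswap m n) false) => //.
  - by move=> a; case: a => i j; have [e1 e2] := Fmn i; have [e3 e4] := Fmn j;
      rewrite /= ?e1 ?e2 ?e3 ?e4.
  - by move=> [] i j //=; lia.
  - by move=> l [i j|i j|i j] [i' j'|i' j'|i' j'] //= [e1 e2]; exists l => /=; f_equal; lia.
  - by move=> a Y; apply: arc_sheaf_noswap hpsif.
have hpsif := psi_swap hp hq hpsi e lF Fmn.
apply: (@phi_sum_transport R k p q hp hq f (psi f) F (act_swap m n) true) => //.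
- by move=> a; case: a => i j; have [e1 e2] := Fmn i; have [e3 e4] := Fmn j;
    rewrite /= ?e1 ?e2 ?e3 ?e4.
- by move=> [] i j //=; lia.
(* The reflection conjugates the deck transformation by [l] into the one by [- l]. *)
- by move=> l [i j|i j|i j] [i' j'|i' j'|i' j'] //= [e1 e2]; exists (- l) => /=;
    f_equal; lia.
- by move=> a Y; apply: arc_sheaf_swap hpsif.
Qed.
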